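(* Under Rayleigh fading, let $P_{\rm r}>0$ and $\mathcal C_x\in[0,1)$, put $\alpha=\frac{P_{\rm r}\pi_{\rm rr}}{P_{\rm r}\pi_{\rm rr}+1}$, $a_i=1+(-1)^i\alpha\mathcal C_x$ for $i=1,2$, $D=P_{\rm r}\pi_{\rm rd}(1-\mathcal C_x^2)$, and assume $D\neq P_{\rm s}\pi_{\rm sd}a_i$ for $i=1,2$. Then the ergodic rate $\mathcal R_{\rm E-E}=\mathbb E[\min(R_{\rm sr},R_{\rm rd})]$ satisfies \[ \mathcal R_{\rm E-E}\ge\frac{D}{P_{\rm s}\pi_{\rm sd}\ln 2}\left(\sum_{i=1}^2\kappa_i\,\Xi_1\!\left(\frac{P_{\rm r}\pi_{\rm rr}a_i}{\alpha P_{\rm s}\pi_{\rm sr}}+\frac{a_i}{D}\right)+\kappa_3\,\Xi_1\!\left(\frac{P_{\rm r}^2\pi_{\rm rd}\pi_{\rm rr}(1-\mathcal C_x^2)}{\alpha P_{\rm s}^2\pi_{\rm sd}\pi_{\rm sr}}+\frac1{P_{\rm s}\pi_{\rm sd}}\right)\right), \] where $\kappa_i=\frac{0.5\,P_{\rm s}\pi_{\rm sd}}{D-P_{\rm s}\pi_{\rm sd}a_i}$ for $i=1,2$ and $\kappa_3=\frac{P_{\rm s}\pi_{\rm sd}(P_{\rm s}\pi_{\rm sd}-D)}{(D-P_{\rm s}\pi_{\rm sd}(1-\alpha\mathcal C_x))(D-P_{\rm s}\pi_{\rm sd}(1+\alpha\mathcal C_x))}$.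
   Context: Let $P_{\rm s}>0$, $P_{\rm r}>0$ be the source and relay transmit powers. Rayleigh fading: $g_{\rm sr},g_{\rm rr},g_{\rm rd},g_{\rm sd}$ are mutually independent exponential random variables with means $\pi_{\rm sr},\pi_{\rm rr},\pi_{\rm rd},\pi_{\rm sd}>0$. For $\mathcal C_x\in[0,1)$ define $R_{\rm sr}(P_{\rm r},\mathcal C_x)=\tfrac12\log_2\frac{(P_{\rm s}g_{\rm sr}+P_{\rm r}g_{\rm rr}+1)^2-(P_{\rm r}g_{\rm rr}\mathcal C_x)^2}{(P_{\rm r}g_{\rm rr}+1)^2-(P_{\rm r}g_{\rm rr}\mathcal C_x)^2}$ and $R_{\rm rd}(P_{\rm r},\mathcal C_x)=\tfrac12\log_2\frac{(P_{\rm r}g_{\rm rd}+P_{\rm s}g_{\rm sd}+1)^2-(P_{\rm r}g_{\rm rd}\mathcal C_x)^2}{(P_{\rm s}g_{\rm sd}+1)^2}$. $\Xi_1(x)=e^xE_1(x)$ where $E_1(x)=\int_1^\infty e^{-xt}t^{-1}dt$ is the exponential integral. *)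

(* Defs.v *)
From Stdlib Require Import Reals Lra ClassicalEpsilon.
Open Scope R_scope.

Definition improper_int_to (f : R -> R) (a l : R) : Prop :=
  (forall b, a <= b -> inhabited (Riemann_integrable f a b)) /\
  (forall eps, eps > 0 -> exists B, forall b (pr : Riemann_integrable f a b),
      B <= b -> Rabs (RiemannInt pr - l) < eps).

Definition Int_inf (f : R -> R) (a : R) : R :=
  match excluded_middle_informative (exists l, improper_int_to f a l) with
  | left H => proj1_sig (constructive_indefinite_description _ H)
  | right _ => 0
  end.

Definition exp_dens (m x : R) : R := / m * exp (- x / m).

(** Expectation of h(g_sr, g_rr, g_rd, g_sd) for independent exponential
    g's with means pi_sr, pi_rr, pi_rd, pi_sd (iterated integral against
    the product density on [0,oo)^4). *)
Definition Expect4 (pi_sr pi_rr pi_rd pi_sd : R) (h : R -> R -> R -> R -> R) : R :=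
  Int_inf (fun x1 => exp_dens pi_sr x1 *
    Int_inf (fun x2 => exp_dens pi_rr x2 *
      Int_inf (fun x3 => exp_dens pi_rd x3 *
        Int_inf (fun x4 => exp_dens pi_sd x4 * h x1 x2 x3 x4) 0) 0) 0) 0.

Definition log2 (y : R) : R := ln y / ln 2.

Definition E1 (x : R) : R := Int_inf (fun t => exp (- (x * t)) / t) 1.
Definition Xi1 (x : R) : R := exp x * E1 x.

Definition R_sr (Ps Pr Cx gsr grr : R) : R :=
  / 2 * log2 (((Ps * gsr + Pr * grr + 1) ^ 2 - (Pr * grr * Cx) ^ 2)
              / ((Pr * grr + 1) ^ 2 - (Pr * grr * Cx) ^ 2)).

Definition R_rd (Ps Pr Cx grd gsd : R) : R :=
  / 2 * log2 (((Pr * grd + Ps * gsd + 1) ^ 2 - (Pr * grd * Cx) ^ 2)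
              / (Ps * gsd + 1) ^ 2).

Definition R_EE (Ps Pr Cx pi_sr pi_rr pi_rd pi_sd : R) : R :=
  Expect4 pi_sr pi_rr pi_rd pi_sd
    (fun gsr grr grd gsd => Rmin (R_sr Ps Pr Cx gsr grr) (R_rd Ps Pr Cx grd gsd)).

(* Main.v *)
(** Each rate is increasing in the desired gain, so expectations are integrals of
    tail probabilities of that gain, and the exponential law turns these tails into
    exponentials.  Write [psi t = 1/2 log2 ((1 + t/a1) (1 + t/a2))].  The event
    [R_rd >= psi t] contains [Pr g_rd (1 - Cx^2) / (Ps g_sd + 1) >= t], whose
    probability is [exp (- t/D) / (1 + Ps pi_sd t / D)].  For fixed [Y = Pr g_rr] the
    event [R_sr >= psi t] is [Ps g_sr >= phi_t Y] with [phi_t] concave, so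
    [exp (- phi_t Y / (Ps pi_sr))] is a convex function of [Y] (although
    [min (R_sr, R_rd)] is not) and Jensen's inequality replaces [Y] by its mean.
    The remaining integral over [t] is evaluated by partial fractions.

    All integrands are Lipschitz in each gain, uniformly in the others, so
    the iterated improper integrals exist and can be interchanged. *)

Require Import Defs.
From Stdlib Require Import Reals Lra Psatz ClassicalEpsilon.
From Coquelicot Require Import Coquelicot.
Open Scope R_scope.

(** * Improper integrals of nonnegative functions *)

(** The level function [psi] is the source-to-relay rate when [Pr g_rr] sits at its mean [q] and
    [Ps g_sr = (1 + q) t]. At that mean the threshold of this hop is linear in [t], so the last
    integrand is an exponential times a rational function. The other hop pays for the choice by
    comparing [1 - C^2] with [a1 a2 = 1 - alpha^2 C^2]. The nesting of [Expect4] is the obstacle: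
    one bound integrates over [g_rd] at fixed [g_sd], and Jensen over [g_rr] comes after integrating
    over [g_sr], while both pairs are nested the other way round. The two exchanges are done on
    rectangles, with errors controlled by a bound on the integrand. The rates are unbounded, so they
    are first capped at [psi T]; a cap can only lower the expectation, and [T] tends to infinity at
    the very end. Tail probabilities never appear as such: integration by parts against the density
    needs only a point at which a level has been reached. Hence the square root in the concave
    threshold is never differentiated; a tangent line, rational in [t], lies above it and takes its
    place. *)

Lemma RInt_Chasles_R (f : R -> R) (a b c : R) :
  ex_RInt f a b -> ex_RInt f b c -> RInt f a c = RInt f a b + RInt f b c.
Proof.
  intros H1 H2. now rewrite <- (RInt_Chasles f a b c H1 H2).
Qed.

Lemma RInt_scal_R (f : R -> R) (a b k : R) :
  ex_RInt f a b -> RInt (fun x => k * f x) a b = k * RInt f a b.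
Proof.
  intros H. exact (RInt_scal f a b k H).
Qed.

Lemma RInt_plus_R (f g : R -> R) (a b : R) :
  ex_RInt f a b -> ex_RInt g a b ->
  RInt (fun x => f x + g x) a b = RInt f a b + RInt g a b.
Proof.
  intros Hf Hg. exact (RInt_plus f g a b Hf Hg).
Qed.

Lemma ex_RInt_scal_R (f : R -> R) (a b k : R) :
  ex_RInt f a b -> ex_RInt (fun x => k * f x) a b.
Proof.
  exact (ex_RInt_scal f a b k).
Qed.

Lemma ex_RInt_plus_R (f g : R -> R) (a b : R) :
  ex_RInt f a b -> ex_RInt g a b -> ex_RInt (fun x => f x + g x) a b.
Proof.
  exact (ex_RInt_plus f g a b).
Qed.

(** [Int_inf] takes its value by choice, so it is identified through uniqueness of limits. The limit
    clause of [improper_int_to] speaks only about given integrability proofs; the first clause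
    supplies one at a [b] beyond both thresholds. *)
Lemma Int_inf_eq (f : R -> R) (a l : R) :
  (forall b, a <= b -> ex_RInt f a b) ->
  is_lim (fun b => RInt f a b) p_infty l -> Int_inf f a = l.
Proof.
  intros Hex Hlim.
  assert (Himp : improper_int_to f a l).
  { split.
    - intros b Hb. constructor. apply ex_RInt_Reals_0. now apply Hex.
    - intros eps Heps. apply is_lim_spec in Hlim.
      destruct (Hlim (mkposreal eps Heps)) as [M HM]. simpl in HM.
      exists (M + 1). intros b pr Hb. rewrite <- RInt_Reals.
      apply HM. lra. }
  unfold Int_inf.
  destruct (excluded_middle_informative _) as [H | H]; [ | exfalso; eauto ].
  destruct (constructive_indefinite_description _ H) as [l' Hl']; simpl.
  destruct Himp as [Hi1 Hi2], Hl' as [_ Hi3].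
  apply cond_eq. intros eps Heps.
  destruct (Hi2 (eps / 2)) as [B1 HB1]; [ lra | ].
  destruct (Hi3 (eps / 2)) as [B2 HB2]; [ lra | ].
  set (b := Rmax a (Rmax B1 B2)).
  assert (Hab : a <= b) by apply Rmax_l.
  assert (H1b : B1 <= b) 
    by (apply Rle_trans with (2 := Rmax_r _ _), Rmax_l).
  assert (H2b : B2 <= b) 
    by (apply Rle_trans with (2 := Rmax_r _ _), Rmax_r).
  destruct (Hi1 b Hab) as [pr].
  specialize (HB1 b pr H1b). specialize (HB2 b pr H2b).
  apply Rabs_def2 in HB1. apply Rabs_def2 in HB2.
  apply Rabs_def1; lra.
Qed.

Lemma RInt_nonneg_mono (f : R -> R) (a b c : R) :
  (forall b, a <= b -> ex_RInt f a b) ->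
  (forall x, a <= x -> 0 <= f x) ->
  a <= b -> b <= c -> RInt f a b <= RInt f a c.
Proof.
  intros Hex Hpos Hb Hc.
  assert (Hbc : ex_RInt f b c)
    by (apply (ex_RInt_Chasles_2 f a b c); [ lra | apply Hex; lra ]).
  rewrite (RInt_Chasles_R f a b c) by auto.
  assert (0 <= RInt f b c).
  { apply RInt_ge_0; auto. intros x Hx. apply Hpos. lra. }
  lra.
Qed.

(** Partial integrals of a nonnegative function increase, so a bound on them yields a limit, their
    supremum. This rules out the default value 0 of [Int_inf]. *)
Lemma is_lim_Int_inf (f : R -> R) (a C : R) :
  (forall b, a <= b -> ex_RInt f a b) ->
  (forall x, a <= x -> 0 <= f x) ->
  (forall b, a <= b -> RInt f a b <= C) ->
  is_lim (fun b => RInt f a b) p_infty (Int_inf f a).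
Proof.
  intros Hex Hpos Hbound.
  destruct (completeness (fun v => exists b, a <= b /\ v = RInt f a b))
    as [l [Hub Hl]].
  - exists C. intros v [b [Hb ->]]. now apply Hbound.
  - exists (RInt f a a). exists a. split; [ lra | reflexivity ].
  - assert (Hlim : is_lim (fun b => RInt f a b) p_infty l).
    { apply is_lim_spec. intros eps.
      assert (Hnub : exists b, a <= b /\ l - eps < RInt f a b).
      { apply Classical_Prop.NNPP. intros Hn.
        assert (l <= l - eps).
        { apply Hl. intros v [b [Hb ->]]. apply Rnot_lt_le. intros Hlt.
          apply Hn. now exists b. }
        destruct eps as [e He]; simpl in *; lra. }
      destruct Hnub as [b [Hb Hlt]].
      exists b. intros x Hx.
      assert (RInt f a x <= l).
      { apply Hub. exists x. split; [ lra | reflexivity ]. }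
      assert (RInt f a b <= RInt f a x) by (apply RInt_nonneg_mono; auto; lra).
      destruct eps as [e He]; simpl in *.
      apply Rabs_def1; lra. }
    now rewrite (Int_inf_eq f a l Hex Hlim).
Qed.

Lemma RInt_le_Int_inf (f : R -> R) (a C b : R) :
  (forall b, a <= b -> ex_RInt f a b) ->
  (forall x, a <= x -> 0 <= f x) ->
  (forall b, a <= b -> RInt f a b <= C) ->
  a <= b -> RInt f a b <= Int_inf f a.
Proof.
  intros Hex Hpos Hbound Hb.
  apply (is_lim_le_loc (fun _ => RInt f a b) (fun c => RInt f a c) p_infty
           (RInt f a b) (Int_inf f a)).
  - exists b. intros c Hc. apply RInt_nonneg_mono; auto; lra.
  - apply is_lim_const.
  - exact (is_lim_Int_inf f a C Hex Hpos Hbound).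
Qed.

Lemma Int_inf_le (f : R -> R) (a C : R) :
  (forall b, a <= b -> ex_RInt f a b) ->
  (forall x, a <= x -> 0 <= f x) ->
  (forall b, a <= b -> RInt f a b <= C) ->
  Int_inf f a <= C.
Proof.
  intros Hex Hpos Hbound.
  apply (is_lim_le_loc (fun c => RInt f a c) (fun _ => C) p_infty
           (Int_inf f a) C).
  - exists a. intros c Hc. apply Hbound; lra.
  - exact (is_lim_Int_inf f a C Hex Hpos Hbound).
  - apply is_lim_const.
Qed.

(** Restricted to the half-line where the gains live, since the logarithms in the rates are not
    controlled for negative gains. The bound gives continuity, hence Riemann integrability, and
    linear growth, hence convergence against an exponential density. *)
Definition lip (k : R) (f : R -> R) : Prop :=
  forall x y, 0 <= x -> 0 <= y -> Rabs (f x - f y) <= k * Rabs (x - y).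

Definition good (k : R) (f : R -> R) : Prop :=
  (forall x, 0 <= x -> 0 <= f x) /\ lip k f.

Lemma lip_const_nonneg (k : R) (f : R -> R) : lip k f -> 0 <= k.
Proof.
  intros H. specialize (H 1 0 ltac:(lra) ltac:(lra)).
  generalize (Rabs_pos (f 1 - f 0)). rewrite Rminus_0_r, Rabs_R1 in H. lra.
Qed.

Lemma Rmax_0_contraction (x y : R) : Rabs (Rmax 0 x - Rmax 0 y) <= Rabs (x - y).
Proof.
  unfold Rmax; destruct (Rle_dec 0 x), (Rle_dec 0 y);
    unfold Rabs; repeat destruct (Rcase_abs _); lra.
Qed.

Lemma lip_continuous (k : R) (f : R -> R) (z : R) :
  (forall x y, Rabs (f x - f y) <= k * Rabs (x - y)) -> continuous f z.
Proof.
  intros H. apply continuity_pt_filterlim.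
  intros eps Heps.
  assert (Hk : 0 <= k).
  { specialize (H 1 0). generalize (Rabs_pos (f 1 - f 0)).
    rewrite Rminus_0_r, Rabs_R1 in H. lra. }
  exists (eps / (k + 1)). split.
  - apply Rdiv_lt_0_compat; lra.
  - intros x [_ Hx]. simpl in *. unfold R_dist, Rdist in *.
    apply Rle_lt_trans with (1 := H x z).
    apply Rle_lt_trans with ((k + 1) * Rabs (x - z)).
    + generalize (Rabs_pos (x - z)). nra.
    + apply Rmult_lt_compat_l with (r := k + 1) in Hx; [ | lra ].
      replace ((k + 1) * (eps / (k + 1))) with eps in Hx by (field; lra). lra.
Qed.

(** Clamping the argument at 0 extends a function from the half-line to the whole line without
    increasing its Lipschitz constant. Continuity results that need a two-sided neighbourhood then
    apply at 0 as well. *)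
Lemma lip_clamp (k : R) (f : R -> R) :
  lip k f ->
  forall x y, Rabs (f (Rmax 0 x) - f (Rmax 0 y)) <= k * Rabs (x - y).
Proof.
  intros H x y.
  assert (Hk := lip_const_nonneg k f H).
  apply Rle_trans with (1 := H (Rmax 0 x) (Rmax 0 y) (Rmax_l _ _) (Rmax_l _ _)).
  apply Rmult_le_compat_l; [ exact Hk | apply Rmax_0_contraction ].
Qed.

(** * Integrals and tails of the exponential density *)

Lemma exp_dens_pos (m x : R) : 0 < m -> 0 < exp_dens m x.
Proof.
  intros Hm. unfold exp_dens. apply Rmult_lt_0_compat.
  - now apply Rinv_0_lt_compat.
  - apply exp_pos.
Qed.

Lemma exp_dens_continuous (m x : R) : continuous (exp_dens m) x.
Proof.
  apply (@ex_derive_continuous R_AbsRing R_NormedModule).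
  unfold exp_dens, Rdiv. auto_derive. exact I.
Qed.

(** Affine integrands cover constants on tails, linear majorants of Lipschitz functions, and the
    supporting lines used for Jensen's inequality. *)
Lemma is_RInt_exp_dens_affine (m u v a b : R) :
  0 < m ->
  is_RInt (fun x => exp_dens m x * (u + v * x)) a b
    (exp (- a / m) * (u + v * (a + m)) - exp (- b / m) * (u + v * (b + m))).
Proof.
  intros Hm.
  replace (exp (- a / m) * (u + v * (a + m)) - exp (- b / m) * (u + v * (b + m)))
    with (minus (- exp (- b / m) * (u + v * (b + m)))
                (- exp (- a / m) * (u + v * (a + m))))
    by (unfold minus, plus, opp; simpl; ring).
  apply (is_RInt_derive (fun x => - exp (- x / m) * (u + v * (x + m)))).
  - intros x _. unfold exp_dens, Rdiv. auto_derive; [ trivial | field; lra ].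
  - intros x _. apply (@ex_derive_continuous R_AbsRing R_NormedModule).
    unfold exp_dens, Rdiv. auto_derive. exact I.
Qed.

Lemma RInt_exp_dens_affine (m u v a b : R) :
  0 < m ->
  RInt (fun x => exp_dens m x * (u + v * x)) a b =
    exp (- a / m) * (u + v * (a + m)) - exp (- b / m) * (u + v * (b + m)).
Proof.
  intros Hm. apply is_RInt_unique. now apply is_RInt_exp_dens_affine.
Qed.

Lemma is_RInt_exp_dens_const (m u a b : R) :
  0 < m ->
  is_RInt (fun x => exp_dens m x * u) a b ((exp (- a / m) - exp (- b / m)) * u).
Proof.
  intros Hm.
  replace ((exp (- a / m) - exp (- b / m)) * u)
    with (exp (- a / m) * (u + 0 * (a + m)) - exp (- b / m) * (u + 0 * (b + m)))
    by ring.
  apply (is_RInt_ext (fun x => exp_dens m x * (u + 0 * x)));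
    [ intros x _; now rewrite Rmult_0_l, Rplus_0_r | ].
  now apply is_RInt_exp_dens_affine.
Qed.

Lemma RInt_exp_dens_const (m u a b : R) :
  0 < m ->
  RInt (fun x => exp_dens m x * u) a b = (exp (- a / m) - exp (- b / m)) * u.
Proof.
  intros Hm. apply is_RInt_unique. now apply is_RInt_exp_dens_const.
Qed.

Lemma ex_RInt_exp_dens_const (m u a b : R) :
  0 < m -> ex_RInt (fun x => exp_dens m x * u) a b.
Proof.
  intros Hm. eexists. now apply is_RInt_exp_dens_const.
Qed.

(** With [x = b / m], squaring [1 + x/2 <= exp (x/2)] gives [x^2/4 <= exp x]. In the witness,
    [m / eps] serves the first bound and [4 * m * m / eps] the second. *)
Lemma exp_opp_div_small (m eps : R) :
  0 < m -> 0 < eps ->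
  exists B, 0 <= B /\
    forall b, B <= b -> exp (- b / m) <= eps /\ exp (- b / m) * b <= eps.
Proof.
  intros Hm He.
  exists (4 * m * m / eps + 1 + m / eps).
  assert (H1 : 0 < m / eps) by (apply Rdiv_lt_0_compat; lra).
  assert (H2 : 0 < 4 * m * m / eps) by (apply Rdiv_lt_0_compat; nra).
  split; [ lra | ]. intros b Hb.
  set (x := b / m).
  assert (Hx : 0 < x) by (apply Rdiv_lt_0_compat; lra).
  assert (Eb : b = x * m) by (unfold x; field; lra).
  assert (Eexp : exp (- b / m) * exp x = 1).
  { rewrite <- exp_plus.
    replace (- b / m + x) with 0 by (unfold x; field; lra). apply exp_0. }
  assert (Hsq : x * x / 4 <= exp x).
  { replace x with (x / 2 + x / 2) at 3 by lra. rewrite exp_plus.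
    generalize (exp_ineq1_le (x / 2)). nra. }
  assert (Hlin := exp_ineq1_le x).
  assert (Hpos := exp_pos (- b / m)).
  set (E := exp (- b / m)) in *.
  assert (m <= eps * b).
  { apply Rmult_le_reg_r with (/ eps); [ now apply Rinv_0_lt_compat | ].
    replace (eps * b * / eps) with b by (field; lra).
    unfold Rdiv in *. lra. }
  assert (4 * m * m <= eps * b).
  { apply Rmult_le_reg_r with (/ eps); [ now apply Rinv_0_lt_compat | ].
    replace (eps * b * / eps) with b by (field; lra).
    unfold Rdiv in *. lra. }
  assert (1 <= eps * x) by (rewrite Eb in *; nra).
  assert (4 * m <= eps * x) by (rewrite Eb in *; nra).
  split.
  - assert (E * x <= 1) by nra. nra.
  - rewrite Eb. assert (E * (x * x) <= 4) by nra.
    assert (E * x * x <= 4) by lra.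
    apply Rmult_le_reg_r with (x * 1); [ lra | ].
    replace (E * (x * m) * (x * 1)) with (E * x * x * m) by ring. nra.
Qed.

(** * Expectation against an exponential density *)

Definition Ex (m : R) (f : R -> R) : R := Int_inf (fun x => exp_dens m x * f x) 0.

Lemma continuous_exp_dens_clamp (m k x : R) (f : R -> R) :
  lip k f -> continuous (fun x => exp_dens m x * f (Rmax 0 x)) x.
Proof.
  intros Hf.
  apply (continuous_mult (exp_dens m) (fun x => f (Rmax 0 x))).
  - apply exp_dens_continuous.
  - apply lip_continuous with k. now apply lip_clamp.
Qed.

Lemma ex_RInt_exp_dens (m k : R) (f : R -> R) (a b : R) :
  lip k f -> 0 <= a -> a <= b -> ex_RInt (fun x => exp_dens m x * f x) a b.
Proof.
  intros Hf Ha Hab.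
  apply (ex_RInt_ext (fun x => exp_dens m x * f (Rmax 0 x))).
  - intros x Hx. rewrite Rmin_left, Rmax_right in Hx by exact Hab.
    rewrite Rmax_right by lra. reflexivity.
  - apply (ex_RInt_continuous (V := R_CompleteNormedModule)).
    intros x _. now apply continuous_exp_dens_clamp with k.
Qed.

Lemma exp_dens_mult_le (m u v x : R) :
  0 < m -> u <= v -> exp_dens m x * u <= exp_dens m x * v.
Proof.
  intros Hm Huv. apply Rmult_le_compat_l; [ left; now apply exp_dens_pos | exact Huv ].
Qed.

Lemma RInt_exp_dens_le (m k k' : R) (f g : R -> R) (a b : R) :
  0 < m -> lip k f -> lip k' g -> 0 <= a -> a <= b ->
  (forall x, a < x < b -> f x <= g x) ->
  RInt (fun x => exp_dens m x * f x) a b <= RInt (fun x => exp_dens m x * g x) a b.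
Proof.
  intros Hm Hf Hg Ha Hab Hfg. apply RInt_le; [ exact Hab | | | ].
  - now apply ex_RInt_exp_dens with k.
  - now apply ex_RInt_exp_dens with k'.
  - intros x Hx. apply exp_dens_mult_le; auto.
Qed.

Lemma lip_const (c : R) : lip 0 (fun _ => c).
Proof.
  intros x y _ _. rewrite Rminus_diag, Rabs_R0. lra.
Qed.

Lemma lip_scal_id (c : R) : lip (Rabs c) (fun x => c * x).
Proof.
  intros x y _ _. rewrite <- Rmult_minus_distr_l, Rabs_mult. lra.
Qed.

Lemma lip_plus (k k' : R) (f g : R -> R) :
  lip k f -> lip k' g -> lip (k + k') (fun x => f x + g x).
Proof.
  intros Hf Hg x y Hx Hy.
  replace (f x + g x - (f y + g y)) with ((f x - f y) + (g x - g y)) by ring.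
  apply Rle_trans with (1 := Rabs_triang _ _).
  specialize (Hf x y Hx Hy). specialize (Hg x y Hx Hy). lra.
Qed.

Lemma exp_div_bounds (m b : R) : 0 < m -> 0 <= b -> 0 < exp (- b / m) <= 1.
Proof.
  intros Hm Hb. split; [ apply exp_pos | ].
  assert (Hbm : 0 <= b / m) by (apply Rdiv_le_0_compat; lra).
  replace (- b / m) with (- (b / m)) by (unfold Rdiv; ring).
  rewrite <- exp_0. destruct Hbm as [Hlt | <-].
  - left. apply exp_increasing. lra.
  - rewrite Ropp_0. lra.
Qed.

Lemma exp_0_div (m : R) : exp (- 0 / m) = 1.
Proof.
  unfold Rdiv. rewrite Ropp_0, Rmult_0_l. apply exp_0.
Qed.

(** A Lipschitz function lies below [f 0 + k x], whose mean is [f 0 + k m]. The bound is uniform in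
    [b], as convergence of the improper integral requires. *)
Lemma RInt_exp_dens_bound (m k b : R) (f : R -> R) :
  0 < m -> good k f -> 0 <= b ->
  RInt (fun x => exp_dens m x * f x) 0 b <= f 0 + k * m.
Proof.
  intros Hm [Hf0 Hf] Hb.
  assert (Hk := lip_const_nonneg k f Hf).
  apply Rle_trans with (RInt (fun x => exp_dens m x * (f 0 + k * x)) 0 b).
  - apply (RInt_exp_dens_le m k (0 + Rabs k) f (fun x => f 0 + k * x)); try lra.
    + exact Hf.
    + apply lip_plus; [ apply lip_const | apply lip_scal_id ].
    + intros x Hx. specialize (Hf x 0 ltac:(lra) ltac:(lra)).
      rewrite Rminus_0_r, (Rabs_pos_eq x) in Hf by lra.
      generalize (Rle_abs (f x - f 0)). lra.
  - rewrite RInt_exp_dens_affine, exp_0_div by exact Hm.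
    assert (H := exp_div_bounds m b Hm Hb).
    specialize (Hf0 0 ltac:(lra)).
    assert (0 <= k * m) by (apply Rmult_le_pos; lra).
    assert (0 <= k * b) by (apply Rmult_le_pos; lra).
    assert (0 <= exp (- b / m) * (f 0 + k * (b + m)))
      by (apply Rmult_le_pos; lra).
    lra.
Qed.

Lemma RInt_le_Ex (m k b : R) (f : R -> R) :
  0 < m -> good k f -> 0 <= b ->
  RInt (fun x => exp_dens m x * f x) 0 b <= Ex m f.
Proof.
  intros Hm Hf Hb. apply RInt_le_Int_inf with (f 0 + k * m); try assumption.
  - intros c Hc. apply ex_RInt_exp_dens with k; try lra. apply Hf.
  - intros x Hx. apply Rmult_le_pos; [ left; now apply exp_dens_pos | now apply Hf ].
  - intros c Hc. now apply RInt_exp_dens_bound.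
Qed.

Lemma Ex_le (m k C : R) (f : R -> R) :
  0 < m -> good k f ->
  (forall b, 0 <= b -> RInt (fun x => exp_dens m x * f x) 0 b <= C) ->
  Ex m f <= C.
Proof.
  intros Hm Hf HC. apply Int_inf_le.
  - intros c Hc. apply ex_RInt_exp_dens with k; try lra. apply Hf.
  - intros x Hx. apply Rmult_le_pos; [ left; now apply exp_dens_pos | now apply Hf ].
  - exact HC.
Qed.

Lemma Ex_nonneg (m k : R) (f : R -> R) : 0 < m -> good k f -> 0 <= Ex m f.
Proof.
  intros Hm Hf.
  apply Rle_trans with (RInt (fun x => exp_dens m x * f x) 0 0).
  - right. symmetry. exact (RInt_point 0 _).
  - apply RInt_le_Ex with k; auto; lra.
Qed.

(** The slack [d] passes through because the density has mass at most 1 on every [[0, b]]. With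
    [d = 0] this is monotonicity; with [d = k' |x - x'|] it transfers Lipschitz bounds in a
    parameter. *)
Lemma Ex_le_shift (m k k' d : R) (f g : R -> R) :
  0 < m -> good k f -> good k' g -> 0 <= d ->
  (forall x, 0 <= x -> f x <= g x + d) -> Ex m f <= Ex m g + d.
Proof.
  intros Hm Hf Hg Hd Hfg. apply Ex_le with k; auto. intros b Hb.
  apply Rle_trans with (RInt (fun x => exp_dens m x * g x + exp_dens m x * d) 0 b).
  - apply RInt_le; auto.
    + apply ex_RInt_exp_dens with k; try lra. apply Hf.
    + apply ex_RInt_plus_R.
      * apply ex_RInt_exp_dens with k'; try lra. apply Hg.
      * now apply ex_RInt_exp_dens_const.
    + intros x Hx. rewrite <- Rmult_plus_distr_l.
      apply exp_dens_mult_le; auto. apply Hfg. lra.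
  - rewrite RInt_plus_R, RInt_exp_dens_const, exp_0_div; auto.
    + assert (H := exp_div_bounds m b Hm Hb).
      assert (HE := RInt_le_Ex m k' b g Hm Hg Hb). nra.
    + apply ex_RInt_exp_dens with k'; try lra. apply Hg.
    + now apply ex_RInt_exp_dens_const.
Qed.

Lemma Ex_mono (m k k' : R) (f g : R -> R) :
  0 < m -> good k f -> good k' g ->
  (forall x, 0 <= x -> f x <= g x) -> Ex m f <= Ex m g.
Proof.
  intros Hm Hf Hg Hfg. rewrite <- (Rplus_0_r (Ex m g)).
  apply Ex_le_shift with k k'; auto; [ lra | ].
  intros x Hx. rewrite Rplus_0_r. auto.
Qed.

Lemma Ex_le_const (m k H : R) (f : R -> R) :
  0 < m -> good k f -> (forall x, 0 <= x -> f x <= H) -> Ex m f <= H.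
Proof.
  intros Hm Hf HH. apply Ex_le with k; auto. intros b Hb.
  apply Rle_trans with (RInt (fun x => exp_dens m x * H) 0 b).
  - apply (RInt_exp_dens_le m k 0 f (fun _ => H)); try lra.
    + apply Hf.
    + apply lip_const.
    + intros x Hx. apply HH. lra.
  - rewrite RInt_exp_dens_const, exp_0_div by exact Hm.
    assert (Hb' := exp_div_bounds m b Hm Hb).
    assert (0 <= H)
      by (apply Rle_trans with (f 0); [ apply Hf | apply HH ]; lra).
    nra.
Qed.

(** Averaging over one gain preserves the Lipschitz constant in another, so each inner expectation
    is again an admissible integrand for the next one. *)
Lemma good_Ex (m k k' : R) (h : R -> R -> R) :
  0 < m ->
  (forall x, 0 <= x -> good k (h x)) ->
  (forall y, 0 <= y -> lip k' (fun x => h x y)) ->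
  good k' (fun x => Ex m (h x)).
Proof.
  intros Hm Hx Hy. split.
  - intros x Hx0. apply Ex_nonneg with k; auto.
  - assert (Hk' := lip_const_nonneg _ _ (Hy 0 (Rle_refl 0))).
    assert (Hone : forall x x', 0 <= x -> 0 <= x' ->
              Ex m (h x) <= Ex m (h x') + k' * Rabs (x - x')).
    { intros x x' Hx0 Hx0'. apply Ex_le_shift with k k; auto.
      - apply Rmult_le_pos; [ exact Hk' | apply Rabs_pos ].
      - intros y Hy0. specialize (Hy y Hy0 x x' Hx0 Hx0').
        generalize (Rle_abs (h x y - h x' y)). lra. }
    intros x x' Hx0 Hx0'.
    assert (H1 := Hone x x' Hx0 Hx0'). assert (H2 := Hone x' x Hx0' Hx0).
    rewrite (Rabs_minus_sym x' x) in H2. apply Rabs_le. lra.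
Qed.

Lemma Ex_le_truncated (m k A H : R) (f : R -> R) :
  0 < m -> good k f -> 0 <= A -> (forall x, 0 <= x -> f x <= H) ->
  Ex m f <= RInt (fun x => exp_dens m x * f x) 0 A + exp (- A / m) * H.
Proof.
  intros Hm Hf HA HH. apply Ex_le with k; auto. intros b Hb.
  assert (Hlip : lip k f) by apply Hf.
  assert (HH0 : 0 <= H)
    by (apply Rle_trans with (f 0); [ apply Hf | apply HH ]; lra).
  assert (HeA := exp_pos (- A / m)).
  destruct (Rle_dec b A) as [HbA | HbA].
  - assert (RInt (fun x => exp_dens m x * f x) 0 b
            <= RInt (fun x => exp_dens m x * f x) 0 A).
    { apply RInt_nonneg_mono; auto.
      - intros c Hc. apply ex_RInt_exp_dens with k; auto; lra.
      - intros x Hx.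
        apply Rmult_le_pos; [ left; now apply exp_dens_pos | now apply Hf ]. }
    nra.
  - rewrite (RInt_Chasles_R _ 0 A b)
      by (apply ex_RInt_exp_dens with k; auto; lra).
    apply Rplus_le_compat_l.
    apply Rle_trans with (RInt (fun x => exp_dens m x * H) A b).
    + apply (RInt_exp_dens_le m k 0 f (fun _ => H)); try lra; auto.
      * apply lip_const.
      * intros x Hx. apply HH. lra.
    + rewrite RInt_exp_dens_const by exact Hm.
      generalize (exp_pos (- b / m)). nra.
Qed.

Definition nondecr (f : R -> R) : Prop :=
  forall x y, 0 <= x -> x <= y -> f x <= f y.

(** Beyond [X] monotonicity replaces [f] by [f X], and that tail has mass [exp (- X / m)]. Stopping
    at a finite [b] loses [exp (- b / m) * f X], which the epsilon absorbs. *)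
Lemma Ex_ge_split (m k X : R) (f : R -> R) :
  0 < m -> good k f -> nondecr f -> 0 <= X ->
  RInt (fun x => exp_dens m x * f x) 0 X + exp (- X / m) * f X <= Ex m f.
Proof.
  intros Hm Hf Hmono HX. apply le_epsilon. intros eps Heps.
  assert (HfX : 0 <= f X) by now apply Hf.
  assert (Hlip : lip k f) by apply Hf.
  destruct (exp_opp_div_small m (eps / (f X + 1)) Hm) as [B [HB0 HB]].
  { apply Rdiv_lt_0_compat; lra. }
  set (b := Rmax X B).
  assert (HXb : X <= b) by apply Rmax_l.
  destruct (HB b (Rmax_r _ _)) as [Hsmall _].
  assert (HfXe : exp (- b / m) * f X <= eps).
  { apply Rle_trans with (exp (- b / m) * (f X + 1)).
    - generalize (exp_pos (- b / m)). nra.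
    - apply Rmult_le_compat_r with (r := f X + 1) in Hsmall; [ | lra ].
      replace (eps / (f X + 1) * (f X + 1)) with eps in Hsmall by (field; lra).
      exact Hsmall. }
  assert (HE := RInt_le_Ex m k b f Hm Hf ltac:(lra)).
  rewrite (RInt_Chasles_R _ 0 X b) in HE
    by (apply ex_RInt_exp_dens with k; auto; lra).
  assert (Htail : RInt (fun x => exp_dens m x * f X) X b
                  <= RInt (fun x => exp_dens m x * f x) X b).
  { apply (RInt_exp_dens_le m 0 k (fun _ => f X) f); try lra; auto.
    - apply lip_const.
    - intros x Hx. apply Hmono; lra. }
  rewrite RInt_exp_dens_const in Htail by exact Hm. lra.
Qed.

(** Jensen's inequality in supporting-line form: [m] is the mean of the law, so the linear term
    averages to zero. Truncation at [b] costs [exp (- b / m) * (u + v * b)]; the constant [c] is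
    chosen so that both parts together stay below [eps]. *)
Lemma Ex_ge_affine (m k u v : R) (f : R -> R) :
  0 < m -> good k f ->
  (forall x, 0 <= x -> u + v * (x - m) <= f x) -> u <= Ex m f.
Proof.
  intros Hm Hf Haff. apply le_epsilon. intros eps Heps.
  set (c := Rabs u + Rabs v + 1).
  assert (Hc : 0 < c) by (unfold c; generalize (Rabs_pos u) (Rabs_pos v); lra).
  destruct (exp_opp_div_small m (eps / c) Hm) as [b [Hb0 Hb]].
  { apply Rdiv_lt_0_compat; lra. }
  destruct (Hb b (Rle_refl b)) as [H1 H2].
  assert (HE := RInt_le_Ex m k b f Hm Hf Hb0).
  assert (Hle : RInt (fun x => exp_dens m x * ((u - v * m) + v * x)) 0 b
                <= RInt (fun x => exp_dens m x * f x) 0 b).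
  { apply (RInt_exp_dens_le m (0 + Rabs v) k (fun x => (u - v * m) + v * x) f); try lra.
    - apply lip_plus; [ apply lip_const | apply lip_scal_id ].
    - apply Hf.
    - intros x Hx. specialize (Haff x ltac:(lra)). lra. }
  rewrite RInt_exp_dens_affine, exp_0_div in Hle by exact Hm.
  assert (Hce : eps / c * c = eps) by (field; lra).
  assert (He := exp_pos (- b / m)).
  assert (exp (- b / m) * u <= eps / c * Rabs u).
  { apply Rle_trans with (exp (- b / m) * Rabs u).
    - apply Rmult_le_compat_l; [ lra | apply Rle_abs ].
    - apply Rmult_le_compat_r; [ apply Rabs_pos | exact H1 ]. }
  assert (exp (- b / m) * b * v <= eps / c * Rabs v).
  { apply Rle_trans with (exp (- b / m) * b * Rabs v).
    - apply Rmult_le_compat_l; [ nra | apply Rle_abs ].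
    - apply Rmult_le_compat_r; [ apply Rabs_pos | exact H2 ]. }
  assert (0 < eps / c) by (apply Rdiv_lt_0_compat; lra).
  assert (eps / c * c = eps / c * Rabs u + eps / c * Rabs v + eps / c)
    by (unfold c; ring).
  lra.
Qed.

(** * Interchange of expectations and the layer-cake bound *)

Lemma ex_RInt_continuous_everywhere (f : R -> R) (a b : R) :
  (forall x, continuous f x) -> ex_RInt f a b.
Proof.
  intros H. apply (ex_RInt_continuous (V := R_CompleteNormedModule)). auto.
Qed.

Lemma is_derive_RInt_upper (f : R -> R) (a b : R) :
  (forall x, continuous f x) -> is_derive (fun u => RInt f a u) b (f b).
Proof.
  intros H. apply (is_derive_RInt f (fun u => RInt f a u) a b).
  - exists (mkposreal 1 Rlt_0_1). intros u _.
    apply (RInt_correct (V := R_CompleteNormedModule)).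
    now apply ex_RInt_continuous_everywhere.
  - apply H.
Qed.

Lemma continuity_2d_pt_slice1 (f : R -> R -> R) (x y : R) :
  continuity_2d_pt f x y -> continuous (fun u => f u y) x.
Proof.
  intros H. apply continuity_pt_filterlim.
  intros eps Heps. destruct (H (mkposreal eps Heps)) as [d Hd].
  exists d. split; [ apply cond_pos | ]. intros u [_ Hu]. apply Hd; [ exact Hu | ].
  rewrite Rminus_diag, Rabs_R0. apply cond_pos.
Qed.

Lemma continuity_2d_pt_slice2 (f : R -> R -> R) (x y : R) :
  continuity_2d_pt f x y -> continuous (fun v => f x v) y.
Proof.
  intros H. apply continuity_pt_filterlim.
  intros eps Heps. destruct (H (mkposreal eps Heps)) as [d Hd].
  exists d. split; [ apply cond_pos | ]. intros v [_ Hv]. apply Hd; [ | exact Hv ].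
  rewrite Rminus_diag, Rabs_R0. apply cond_pos.
Qed.

Lemma continuity_2d_pt_swap (f : R -> R -> R) (x y : R) :
  continuity_2d_pt f x y -> continuity_2d_pt (fun v u => f u v) y x.
Proof.
  intros H eps. destruct (H eps) as [d Hd].
  exists d. intros v u Hv Hu. now apply Hd.
Qed.

Lemma continuous_RInt_param (f : R -> R -> R) (c d x : R) :
  c <= d -> (forall u v, continuity_2d_pt f u v) ->
  continuous (fun u => RInt (f u) c d) x.
Proof.
  intros Hcd Hf.
  assert (Hex : forall u, ex_RInt (f u) c d).
  { intros u. apply ex_RInt_continuous_everywhere.
    intros v. now apply continuity_2d_pt_slice2. }
  apply continuity_pt_filterlim. intros eps Heps.
  (* The [+ 1] allows [c = d] and makes the final estimate strict. *)
  assert (He' : 0 < eps / (d - c + 1)) by (apply Rdiv_lt_0_compat; lra).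
  destruct (uniform_continuity_2d_1d' f c d x (fun v _ => Hf x v)
              (mkposreal _ He')) as [delta Hdelta].
  simpl in Hdelta. assert (Hdpos := cond_pos delta).
  exists delta. split; [ exact Hdpos | ]. intros u [_ Hu].
  simpl in *. unfold Rdist, R_dist in *.
  apply Rabs_def2 in Hu.
  assert (Hdiff : forall v, c <= v <= d -> Rabs (f u v - f x v) <= eps / (d - c + 1)).
  { intros v Hv. left. apply (Hdelta v x v u); try lra.
    rewrite Rminus_diag, Rabs_R0. lra. }
  assert (Hm : ex_RInt (fun v => f u v - f x v) c d)
    by (now apply (ex_RInt_minus (V := R_NormedModule))).
  replace (RInt (f u) c d - RInt (f x) c d)
    with (RInt (fun v => f u v - f x v) c d)
    by (exact (RInt_minus (V := R_CompleteNormedModule) _ _ _ _ (Hex u) (Hex x))).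
  apply Rle_lt_trans with (1 := abs_RInt_le_const _ _ _ _ Hcd Hm Hdiff).
  apply Rlt_le_trans with ((d - c + 1) * (eps / (d - c + 1))).
  - apply Rmult_lt_compat_r; lra.
  - right. field. lra.
Qed.

(** Fubini on a rectangle by differentiation in the upper limit: [RInt (F u) c d] vanishes at
    [u = a] and, by differentiation under the integral sign, has derivative [RInt (f u) c d]. *)
Lemma RInt_swap (f : R -> R -> R) (a b c d : R) :
  c <= d -> (forall x y, continuity_2d_pt f x y) ->
  RInt (fun x => RInt (fun y => f x y) c d) a b
  = RInt (fun y => RInt (fun x => f x y) a b) c d.
Proof.
  intros Hcd Hf.
  assert (Hslice : forall y x, continuous (fun x => f x y) x).
  { intros y x. now apply continuity_2d_pt_slice1. }
  set (F := fun u y => RInt (fun x => f x y) a u).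
  assert (HF : forall u y, is_derive (fun u => F u y) u (f u y)).
  { intros u y. apply (is_derive_RInt_upper (fun x => f x y)). apply Hslice. }
  assert (HFy : forall u y, a <= u -> continuous (F u) y).
  { intros u y Hu. apply (continuous_RInt_param (fun y x => f x y)); auto.
    intros y' x'. apply (continuity_2d_pt_swap f), Hf. }
  assert (HFex : forall u, ex_RInt (F u) c d).
  { intros u. destruct (Rle_dec a u) as [Hu | Hu].
    - apply ex_RInt_continuous_everywhere. intros y. now apply HFy.
    - apply (ex_RInt_ext (fun y => opp (RInt (fun x => f x y) u a))).
      + intros y _. apply (opp_RInt_swap (V := R_CompleteNormedModule)).
        apply ex_RInt_continuous_everywhere. apply Hslice.
      + apply (ex_RInt_opp (V := R_NormedModule)).
        apply ex_RInt_continuous_everywhere. intros y.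
        apply (continuous_RInt_param (fun y x => f x y)); [ lra | ].
        intros y' x'. apply (continuity_2d_pt_swap f), Hf. }
  assert (HD : forall u, is_derive (fun u => RInt (F u) c d) u (RInt (f u) c d)).
  { intros u.
    rewrite <- (RInt_ext (fun y => Derive (fun u => F u y) u))
      by (intros y _; apply is_derive_unique, HF).
    apply (is_derive_RInt_param F c d u).
    - exists (mkposreal 1 Rlt_0_1). intros u' _ y _. eexists. apply HF.
    - intros y _. apply continuity_2d_pt_ext with f; [ | apply Hf ].
      intros p q. symmetry. apply is_derive_unique, HF.
    - exists (mkposreal 1 Rlt_0_1). intros u' _. apply HFex. }
  apply is_RInt_unique.
  replace (RInt (fun y => RInt (fun x => f x y) a b) c d)
    with (minus (RInt (F b) c d) (RInt (F a) c d)).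
  - apply (is_RInt_derive (fun u => RInt (F u) c d) (fun u => RInt (f u) c d)).
    + intros u _. apply HD.
    + intros u _. now apply continuous_RInt_param.
  - unfold minus, plus, opp; simpl.
    replace (RInt (F a) c d) with 0; [ unfold F; simpl; lra | ].
    symmetry. transitivity (RInt (fun _ => 0) c d).
    + apply RInt_ext. intros y _. exact (RInt_point a _).
    + rewrite RInt_const. apply Rmult_0_r.
Qed.

(** Moving one coordinate at a time, separate Lipschitz bounds give joint continuity because each
    constant is uniform in the other variable. *)
Lemma lip2_continuity_2d_pt (k1 k2 x y : R) (h : R -> R -> R) :
  (forall v, 0 <= v -> lip k1 (fun u => h u v)) ->
  (forall u, 0 <= u -> lip k2 (h u)) ->
  continuity_2d_pt (fun u v => h (Rmax 0 u) (Rmax 0 v)) x y.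
Proof.
  intros H1 H2 eps.
  assert (Hk1 := lip_const_nonneg _ _ (H1 0 (Rle_refl 0))).
  assert (Hk2 := lip_const_nonneg _ _ (H2 0 (Rle_refl 0))).
  assert (Heps := cond_pos eps).
  assert (Hd : 0 < eps / (k1 + k2 + 1)) by (apply Rdiv_lt_0_compat; lra).
  exists (mkposreal _ Hd). intros u v Hu Hv. simpl in Hu, Hv.
  replace (h (Rmax 0 u) (Rmax 0 v) - h (Rmax 0 x) (Rmax 0 y))
    with ((h (Rmax 0 u) (Rmax 0 v) - h (Rmax 0 x) (Rmax 0 v))
          + (h (Rmax 0 x) (Rmax 0 v) - h (Rmax 0 x) (Rmax 0 y))) by ring.
  apply Rle_lt_trans with (1 := Rabs_triang _ _).
  assert (L1 := lip_clamp k1 _ (H1 (Rmax 0 v) (Rmax_l _ _)) u x).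
  assert (L2 := lip_clamp k2 _ (H2 (Rmax 0 x) (Rmax_l _ _)) v y).
  simpl in L1, L2.
  set (e := eps / (k1 + k2 + 1)) in *.
  assert (Hee : (k1 + k2 + 1) * e = eps) by (unfold e; field; lra).
  assert (k1 * Rabs (u - x) <= k1 * e) by (apply Rmult_le_compat_l; lra).
  assert (k2 * Rabs (v - y) <= k2 * e) by (apply Rmult_le_compat_l; lra).
  lra.
Qed.

(** Tonelli in the single direction that a lower bound requires. The integrals are exchanged on a
    rectangle, and nonnegativity lets the rectangle grow back on the right. The bound [H] makes the
    mass beyond [a] small uniformly in [y]; this is the reason for capping the rates before an
    exchange. *)
Lemma Ex_swap_le (m1 m2 k1 k2 H : R) (h : R -> R -> R) :
  0 < m1 -> 0 < m2 ->
  (forall y, 0 <= y -> lip k1 (fun x => h x y)) ->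
  (forall x, 0 <= x -> lip k2 (h x)) ->
  (forall x y, 0 <= x -> 0 <= y -> 0 <= h x y <= H) ->
  Ex m2 (fun y => Ex m1 (fun x => h x y)) <= Ex m1 (fun x => Ex m2 (h x)).
Proof.
  intros Hm1 Hm2 H1 H2 Hh.
  assert (G1 : forall y, 0 <= y -> good k1 (fun x => h x y)).
  { intros y Hy. split; auto. intros x Hx. now apply Hh. }
  assert (G2 : forall x, 0 <= x -> good k2 (h x)).
  { intros x Hx. split; auto. intros y Hy. now apply Hh. }
  assert (GE1 : good k2 (fun y => Ex m1 (fun x => h x y))).
  { apply (good_Ex m1 k1 k2 (fun y x => h x y)); auto. }
  assert (GE2 : good k1 (fun x => Ex m2 (h x))).
  { apply (good_Ex m2 k2 k1 h); auto. }
  assert (HH0 : 0 <= H) by (destruct (Hh 0 0 (Rle_refl 0) (Rle_refl 0)); lra).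
  apply Ex_le with k2; auto. intros b Hb. apply le_epsilon. intros eps Heps.
  destruct (exp_opp_div_small m1 (eps / (H + 1)) Hm1) as [a [Ha0 Ha]].
  { apply Rdiv_lt_0_compat; lra. }
  destruct (Ha a (Rle_refl a)) as [Hsmall _].
  assert (HHe : exp (- a / m1) * H <= eps).
  { apply Rle_trans with (exp (- a / m1) * (H + 1)).
    - generalize (exp_pos (- a / m1)). nra.
    - apply Rmult_le_compat_r with (r := H + 1) in Hsmall; [ | lra ].
      replace (eps / (H + 1) * (H + 1)) with eps in Hsmall by (field; lra).
      exact Hsmall. }
  set (f := fun x y => exp_dens m1 x * exp_dens m2 y * h (Rmax 0 x) (Rmax 0 y)).
  assert (Hf : forall x y, continuity_2d_pt f x y).
  { intros x y. apply continuity_2d_pt_mult.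
    - apply continuity_2d_pt_mult;
        apply continuity_1d_2d_pt_comp;
        try apply continuity_2d_pt_id1; try apply continuity_2d_pt_id2;
        apply continuity_pt_filterlim, exp_dens_continuous.
    - now apply lip2_continuity_2d_pt with k1 k2. }
  (* the mass of the inner integral beyond [a] is at most [eps] *)
  assert (Hcut : RInt (fun y => exp_dens m2 y * Ex m1 (fun x => h x y)) 0 b
      <= RInt (fun y => RInt (fun x => f x y) 0 a + exp_dens m2 y * eps) 0 b).
  { assert (Hc : forall y, continuous (fun y => RInt (fun x => f x y) 0 a) y).
    { intros y. apply (continuous_RInt_param (fun y x => f x y)); auto.
      intros y' x'. apply (continuity_2d_pt_swap f), Hf. }
    apply RInt_le; auto.
    - apply ex_RInt_exp_dens with k2; auto; try lra. apply GE1.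
    - apply ex_RInt_plus_R.
      + now apply ex_RInt_continuous_everywhere.
      + now apply ex_RInt_exp_dens_const.
    - intros y Hy.
      replace (RInt (fun x => f x y) 0 a)
        with (exp_dens m2 y * RInt (fun x => exp_dens m1 x * h x y) 0 a).
      + rewrite <- Rmult_plus_distr_l. apply exp_dens_mult_le; auto.
        apply Rle_trans with
          (1 := Ex_le_truncated m1 k1 a H _ Hm1 (G1 y ltac:(lra)) Ha0
                  (fun x Hx => proj2 (Hh x y Hx ltac:(lra)))).
        lra.
      + rewrite <- RInt_scal_R
          by (apply ex_RInt_exp_dens with k1; try lra; apply H1; lra).
        apply RInt_ext. intros x Hx.
        rewrite Rmin_left, Rmax_right in Hx by lra.
        unfold f. rewrite !Rmax_right by lra.
        rewrite <- Rmult_assoc. now rewrite (Rmult_comm (exp_dens m2 y)). }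
  apply Rle_trans with (1 := Hcut).
  rewrite RInt_plus_R, <- RInt_swap; auto.
  - apply Rplus_le_compat.
    + apply Rle_trans with (2 := RInt_le_Ex m1 k1 a _ Hm1 GE2 Ha0).
      apply RInt_le; auto.
      * apply ex_RInt_continuous_everywhere. intros x.
        now apply continuous_RInt_param.
      * apply ex_RInt_exp_dens with k1; auto; try lra. apply GE2.
      * intros x Hx.
        apply Rle_trans with
          (exp_dens m1 x * RInt (fun y => exp_dens m2 y * h x y) 0 b).
        -- right. rewrite <- RInt_scal_R
             by (apply ex_RInt_exp_dens with k2; try lra; apply H2; lra).
           apply RInt_ext. intros y Hy.
           rewrite Rmin_left, Rmax_right in Hy by lra.
           unfold f. rewrite !Rmax_right by lra. apply Rmult_assoc.
        -- apply exp_dens_mult_le; auto.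
           apply RInt_le_Ex with k2; auto. apply G2; lra.
    + rewrite RInt_exp_dens_const, exp_0_div by auto.
      generalize (exp_pos (- b / m2)). nra.
  - apply ex_RInt_continuous_everywhere. intros y.
    apply (continuous_RInt_param (fun y x => f x y)); auto.
    intros y' x'. apply (continuity_2d_pt_swap f), Hf.
  - now apply ex_RInt_exp_dens_const.
Qed.

(* Layer-cake bound: if [f] has reached level [N t] by the point [phi t], then
   integrating by parts against the exponential tail bounds its expectation. *)
Lemma Ex_ge_layer (m k T : R) (f phi dphi N n : R -> R) :
  0 < m -> good k f -> nondecr f -> 0 <= T ->
  (forall t, 0 <= t <= T ->
     is_derive phi t (dphi t) /\ continuous dphi t /\ 0 <= dphi t /\ 0 <= phi t) ->
  (forall t, 0 <= t <= T ->
     is_derive N t (n t) /\ continuous n t /\ N t <= f (phi t)) ->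
  phi 0 = 0 -> N 0 = 0 ->
  RInt (fun t => n t * exp (- phi t / m)) 0 T <= Ex m f.
Proof.
  intros Hm Hf Hmono HT Hphi HN Hphi0 HN0.
  assert (Hlip : lip k f) by apply Hf.
  set (g := fun x => exp_dens m x * f (Rmax 0 x)).
  assert (Hg : forall x, continuous g x)
    by (intros x; now apply continuous_exp_dens_clamp with k).
  (* At [T] this is the lower bound of [Ex_ge_split] for the point [phi T], with [f (phi T)]
     weakened to [N T]. In its derivative the tail terms combine to [n t * exp (- phi t / m)] plus a
     nonnegative multiple of [f (phi t) - N t]. *)
  set (P := fun t => RInt g 0 (phi t) + exp (- phi t / m) * N t).
  set (dP := fun t => dphi t * g (phi t)
                      + (exp (- phi t / m) * (- dphi t / m) * N t
                         + exp (- phi t / m) * n t)).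
  assert (Hcphi : forall t, 0 <= t <= T -> continuous phi t).
  { intros t Ht. apply (@ex_derive_continuous R_AbsRing R_NormedModule).
    eexists. now apply Hphi. }
  assert (HcN : forall t, 0 <= t <= T -> continuous N t).
  { intros t Ht. apply (@ex_derive_continuous R_AbsRing R_NormedModule).
    eexists. now apply HN. }
  assert (Hcexp : forall t, 0 <= t <= T -> continuous (fun t => exp (- phi t / m)) t).
  { intros t Ht. apply (continuous_comp phi (fun x => exp (- x / m))); auto.
    apply (@ex_derive_continuous R_AbsRing R_NormedModule).
    unfold Rdiv. auto_derive. exact I. }
  assert (HdP : forall t, 0 <= t <= T -> is_derive P t (dP t)).
  { intros t Ht. destruct (Hphi t Ht) as [D1 _]. destruct (HN t Ht) as [D2 _].
    apply (is_derive_plus (fun t => RInt g 0 (phi t))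
             (fun t => exp (- phi t / m) * N t)).
    - apply (is_derive_comp (fun u => RInt g 0 u) phi); [ | exact D1 ].
      now apply is_derive_RInt_upper.
    - apply (is_derive_mult (fun t => exp (- phi t / m)) N).
      + replace (exp (- phi t / m) * (- dphi t / m))
          with (scal (dphi t) (- / m * exp (- phi t / m)))
          by (unfold scal; simpl; unfold mult; simpl; field; lra).
        apply (is_derive_comp (fun x => exp (- x / m)) phi); [ | exact D1 ].
        unfold Rdiv. auto_derive; [ exact I | ring ].
      + exact D2.
      + intros u v. apply Rmult_comm. }
  assert (HcdP : forall t, 0 <= t <= T -> continuous dP t).
  { intros t Ht. destruct (Hphi t Ht) as (_ & C1 & _). destruct (HN t Ht) as (_ & C2 & _).
    apply (continuous_plus (fun t => dphi t * g (phi t))).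
    - apply (continuous_mult dphi (fun t => g (phi t))); auto.
      apply (continuous_comp phi g); auto.
    - apply (continuous_plus (fun t => exp (- phi t / m) * (- dphi t / m) * N t)).
      + apply (continuous_mult (fun t => exp (- phi t / m) * (- dphi t / m)) N); auto.
        apply (continuous_mult (fun t => exp (- phi t / m)) (fun t => - dphi t / m)); auto.
        apply (continuous_comp dphi (fun x => - x / m)); auto.
        apply (@ex_derive_continuous R_AbsRing R_NormedModule).
        unfold Rdiv. auto_derive. exact I.
      + apply (continuous_mult (fun t => exp (- phi t / m)) n); auto. }
  assert (HPT : is_RInt dP 0 T (minus (P T) (P 0))).
  { apply (is_RInt_derive P dP); intros t Ht;
      rewrite Rmin_left, Rmax_right in Ht by exact HT; auto. }
  assert (HP0 : P 0 = 0).
  { unfold P. rewrite Hphi0, HN0, Rmult_0_r, Rplus_0_r. exact (RInt_point 0 g). }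
  assert (HphiT : 0 <= phi T) by (apply Hphi; lra).
  assert (HPE : P T <= Ex m f).
  { apply Rle_trans with (2 := Ex_ge_split m k (phi T) f Hm Hf Hmono HphiT).
    unfold P. apply Rplus_le_compat.
    - right. apply RInt_ext. intros x Hx.
      rewrite Rmin_left, Rmax_right in Hx by exact HphiT.
      unfold g. rewrite Rmax_right by lra. reflexivity.
    - apply Rmult_le_compat_l; [ left; apply exp_pos | apply HN; lra ]. }
  apply Rle_trans with (2 := HPE).
  replace (P T) with (RInt dP 0 T).
  - apply RInt_le; auto.
    + apply (ex_RInt_continuous (V := R_CompleteNormedModule)). intros t Ht.
      rewrite Rmin_left, Rmax_right in Ht by exact HT.
      apply (continuous_mult n (fun t => exp (- phi t / m))); auto.
      now apply HN.
    + eexists. exact HPT.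
    + intros t Ht.
      destruct (Hphi t ltac:(lra)) as (_ & _ & P1 & P2).
      destruct (HN t ltac:(lra)) as (_ & _ & P3).
      unfold dP, g. rewrite Rmax_right by exact P2.
      replace (dphi t * (exp_dens m (phi t) * f (phi t))
               + (exp (- phi t / m) * (- dphi t / m) * N t + exp (- phi t / m) * n t))
        with (dphi t * (exp_dens m (phi t) * (f (phi t) - N t))
              + n t * exp (- phi t / m))
        by (unfold exp_dens; field; lra).
      assert (0 <= dphi t * (exp_dens m (phi t) * (f (phi t) - N t))).
      { apply Rmult_le_pos; auto. apply Rmult_le_pos; [ | lra ].
        left. now apply exp_dens_pos. }
      lra.
  - rewrite (is_RInt_unique _ _ _ _ HPT), HP0. unfold minus, plus, opp; simpl. lra.
Qed.

(** * The two rates *)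

Lemma ln2_pos : 0 < ln 2.
Proof.
  rewrite <- ln_1. apply ln_increasing; lra.
Qed.

Lemma log2_le (x y : R) : 0 < x -> x <= y -> log2 x <= log2 y.
Proof.
  intros Hx Hxy. unfold log2. apply Rmult_le_compat_r.
  - left. apply Rinv_0_lt_compat, ln2_pos.
  - now apply ln_le.
Qed.

Lemma ln_minus_le (u v : R) : 1 <= u -> 1 <= v -> ln u - ln v <= Rabs (u - v).
Proof.
  intros Hu Hv. rewrite <- ln_div by lra.
  assert (Hpos : 0 < u / v) by (apply Rdiv_lt_0_compat; lra).
  assert (H := exp_ineq1_le (ln (u / v))). rewrite exp_ln in H by exact Hpos.
  assert (Hw : u / v - 1 <= Rabs (u - v)); [ | lra ].
  replace (u / v - 1) with ((u - v) / v) by (field; lra).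
  apply Rle_div_l; [ lra | ].
  generalize (Rle_abs (u - v)) (Rabs_pos (u - v)). nra.
Qed.

Lemma lip_ln_affine (a b : R) : 1 <= a -> 0 <= b -> lip b (fun x => ln (a + b * x)).
Proof.
  intros Ha Hb x y Hx Hy.
  assert (1 <= a + b * x) by nra. assert (1 <= a + b * y) by nra.
  assert (Hd : Rabs (a + b * x - (a + b * y)) = b * Rabs (x - y)).
  { replace (a + b * x - (a + b * y)) with (b * (x - y)) by ring.
    rewrite Rabs_mult, (Rabs_pos_eq b) by exact Hb. reflexivity. }
  rewrite <- Hd. apply Rabs_le. split.
  - assert (H' := ln_minus_le (a + b * y) (a + b * x)).
    rewrite Rabs_minus_sym in H'. lra.
  - apply ln_minus_le; assumption.
Qed.

Lemma lip_scal (k c : R) (f : R -> R) :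
  0 <= c -> lip k f -> lip (c * k) (fun x => c * f x).
Proof.
  intros Hc Hf x y Hx Hy.
  rewrite <- Rmult_minus_distr_l, Rabs_mult, (Rabs_pos_eq c), Rmult_assoc by exact Hc.
  apply Rmult_le_compat_l; auto.
Qed.

Lemma lip_opp (k : R) (f : R -> R) : lip k f -> lip k (fun x => - f x).
Proof.
  intros Hf x y Hx Hy.
  replace (- f x - - f y) with (f y - f x) by ring.
  rewrite Rabs_minus_sym. now apply Hf.
Qed.

Lemma lip_ext (k : R) (f g : R -> R) :
  (forall x, 0 <= x -> f x = g x) -> lip k f -> lip k g.
Proof.
  intros Hfg Hf x y Hx Hy. rewrite <- !Hfg by assumption. auto.
Qed.

Lemma Rmin_l_contraction (a a' c : R) : Rabs (Rmin a c - Rmin a' c) <= Rabs (a - a').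
Proof.
  unfold Rmin. destruct (Rle_dec a c), (Rle_dec a' c);
    unfold Rabs; repeat destruct (Rcase_abs _); lra.
Qed.

Lemma lip_Rmin_l (k c : R) (f : R -> R) : lip k f -> lip k (fun x => Rmin (f x) c).
Proof.
  intros Hf x y Hx Hy.
  apply Rle_trans with (1 := Rmin_l_contraction _ _ _). auto.
Qed.

Lemma lip_Rmin_r (k c : R) (f : R -> R) : lip k f -> lip k (fun x => Rmin c (f x)).
Proof.
  intros Hf. apply lip_ext with (fun x => Rmin (f x) c).
  - intros x _. apply Rmin_comm.
  - now apply lip_Rmin_l.
Qed.

Lemma lip_id : lip 1 (fun x => x).
Proof.
  intros x y _ _. lra.
Qed.

(** Common shape of both rates in each of their gains. The other gain enters only through the [a]'s,
    which stay at least 1, while the constant involves only the [b]'s; hence the uniformity. *)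
Lemma lip_log_ratio (c a1 a2 a3 a4 b1 b2 b3 b4 : R) :
  0 <= c -> 1 <= a1 -> 1 <= a2 -> 1 <= a3 -> 1 <= a4 ->
  0 <= b1 -> 0 <= b2 -> 0 <= b3 -> 0 <= b4 ->
  lip (c * (b1 + b2 + b3 + b4))
    (fun x => c * (ln (a1 + b1 * x) + ln (a2 + b2 * x)
                   + - ln (a3 + b3 * x) + - ln (a4 + b4 * x))).
Proof.
  intros. apply lip_scal; [ assumption | ].
  repeat apply lip_plus; try apply lip_opp; now apply lip_ln_affine.
Qed.

Lemma half_log2_ratio (u v w z : R) :
  0 < u -> 0 < v -> 0 < w -> 0 < z ->
  / 2 * log2 (u * v / (w * z)) = / (2 * ln 2) * (ln u + ln v + - ln w + - ln z).
Proof.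
  intros Hu Hv Hw Hz. unfold log2.
  rewrite ln_div, !ln_mult; try assumption; try now apply Rmult_lt_0_compat.
  field. apply Rgt_not_eq, ln2_pos.
Qed.


(** Factoring the differences of squares leaves logarithms of affine functions that are at least 1
    for nonnegative gains, from which sign, monotonicity and Lipschitz bounds can be read off. *)
Lemma R_sr_ln (Ps Pr C x y : R) :
  0 < Ps -> 0 < Pr -> 0 <= C < 1 -> 0 <= x -> 0 <= y ->
  R_sr Ps Pr C x y =
  / (2 * ln 2) *
    (ln (1 + Pr * (1 - C) * y + Ps * x) + ln (1 + Pr * (1 + C) * y + Ps * x)
     + - ln (1 + Pr * (1 - C) * y) + - ln (1 + Pr * (1 + C) * y)).
Proof.
  intros HPs HPr HC Hx Hy. unfold R_sr.
  assert (0 <= Ps * x) by nra.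
  assert (0 <= Pr * (1 - C) * y) by (assert (0 <= Pr * (1 - C)); nra).
  assert (0 <= Pr * (1 + C) * y) by (assert (0 <= Pr * (1 + C)); nra).
  rewrite <- half_log2_ratio by lra. do 2 f_equal. unfold Rdiv. f_equal; [ ring | ].
  f_equal; ring.
Qed.

Lemma R_rd_ln (Ps Pr C z w : R) :
  0 < Ps -> 0 < Pr -> 0 <= C < 1 -> 0 <= z -> 0 <= w ->
  R_rd Ps Pr C z w =
  / (2 * ln 2) *
    (ln (1 + Ps * w + Pr * (1 - C) * z) + ln (1 + Ps * w + Pr * (1 + C) * z)
     + - ln (1 + Ps * w) + - ln (1 + Ps * w)).
Proof.
  intros HPs HPr HC Hz Hw. unfold R_rd.
  assert (0 <= Ps * w) by nra.
  assert (0 <= Pr * (1 - C) * z) by (assert (0 <= Pr * (1 - C)); nra).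
  assert (0 <= Pr * (1 + C) * z) by (assert (0 <= Pr * (1 + C)); nra).
  rewrite <- half_log2_ratio by lra. do 2 f_equal. unfold Rdiv. f_equal; [ ring | ].
  f_equal; ring.
Qed.

Lemma half_inv_ln2_pos : 0 < / (2 * ln 2).
Proof.
  apply Rinv_0_lt_compat. generalize ln2_pos. lra.
Qed.

Lemma R_sr_nonneg (Ps Pr C x y : R) :
  0 < Ps -> 0 < Pr -> 0 <= C < 1 -> 0 <= x -> 0 <= y -> 0 <= R_sr Ps Pr C x y.
Proof.
  intros HPs HPr HC Hx Hy. rewrite R_sr_ln by assumption.
  assert (0 <= Ps * x) by nra.
  assert (0 <= Pr * (1 - C) * y) by (assert (0 <= Pr * (1 - C)); nra).
  assert (0 <= Pr * (1 + C) * y) by (assert (0 <= Pr * (1 + C)); nra).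
  apply Rmult_le_pos; [ left; apply half_inv_ln2_pos | ].
  assert (ln (1 + Pr * (1 - C) * y) <= ln (1 + Pr * (1 - C) * y + Ps * x))
    by (apply ln_le; lra).
  assert (ln (1 + Pr * (1 + C) * y) <= ln (1 + Pr * (1 + C) * y + Ps * x))
    by (apply ln_le; lra).
  lra.
Qed.

Lemma R_rd_nonneg (Ps Pr C z w : R) :
  0 < Ps -> 0 < Pr -> 0 <= C < 1 -> 0 <= z -> 0 <= w -> 0 <= R_rd Ps Pr C z w.
Proof.
  intros HPs HPr HC Hz Hw. rewrite R_rd_ln by assumption.
  assert (0 <= Ps * w) by nra.
  assert (0 <= Pr * (1 - C) * z) by (assert (0 <= Pr * (1 - C)); nra).
  assert (0 <= Pr * (1 + C) * z) by (assert (0 <= Pr * (1 + C)); nra).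
  apply Rmult_le_pos; [ left; apply half_inv_ln2_pos | ].
  assert (ln (1 + Ps * w) <= ln (1 + Ps * w + Pr * (1 - C) * z))
    by (apply ln_le; lra).
  assert (ln (1 + Ps * w) <= ln (1 + Ps * w + Pr * (1 + C) * z))
    by (apply ln_le; lra).
  lra.
Qed.

Lemma nondecr_R_sr (Ps Pr C y : R) :
  0 < Ps -> 0 < Pr -> 0 <= C < 1 -> 0 <= y -> nondecr (fun x => R_sr Ps Pr C x y).
Proof.
  intros HPs HPr HC Hy x x' Hx Hxx. rewrite !R_sr_ln by (assumption || lra).
  assert (0 <= Ps * x) by nra. assert (Ps * x <= Ps * x') by nra.
  assert (0 <= Pr * (1 - C) * y) by (assert (0 <= Pr * (1 - C)); nra).
  assert (0 <= Pr * (1 + C) * y) by (assert (0 <= Pr * (1 + C)); nra).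
  apply Rmult_le_compat_l; [ left; apply half_inv_ln2_pos | ].
  repeat apply Rplus_le_compat; try apply Rle_refl; apply ln_le; lra.
Qed.

Lemma nondecr_R_rd (Ps Pr C w : R) :
  0 < Ps -> 0 < Pr -> 0 <= C < 1 -> 0 <= w -> nondecr (fun z => R_rd Ps Pr C z w).
Proof.
  intros HPs HPr HC Hw z z' Hz Hzz. rewrite !R_rd_ln by (assumption || lra).
  assert (0 <= Ps * w) by nra.
  assert (0 <= Pr * (1 - C)) by nra. assert (0 <= Pr * (1 + C)) by nra.
  assert (0 <= Pr * (1 - C) * z) by nra. assert (0 <= Pr * (1 + C) * z) by nra.
  assert (Pr * (1 - C) * z <= Pr * (1 - C) * z') by nra.
  assert (Pr * (1 + C) * z <= Pr * (1 + C) * z') by nra.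
  apply Rmult_le_compat_l; [ left; apply half_inv_ln2_pos | ].
  repeat apply Rplus_le_compat; try apply Rle_refl; apply ln_le; lra.
Qed.

Lemma lip_R_sr (Ps Pr C : R) :
  0 < Ps -> 0 < Pr -> 0 <= C < 1 ->
  exists k1 k2,
    (forall y, 0 <= y -> lip k1 (fun x => R_sr Ps Pr C x y)) /\
    (forall x, 0 <= x -> lip k2 (R_sr Ps Pr C x)).
Proof.
  intros HPs HPr HC.
  assert (H1 : 0 <= Pr * (1 - C)) by nra. assert (H2 : 0 <= Pr * (1 + C)) by nra.
  assert (Hc := half_inv_ln2_pos).
  do 2 eexists. split.
  - intros y Hy.
    assert (0 <= Pr * (1 - C) * y) by nra. assert (0 <= Pr * (1 + C) * y) by nra.
    eapply lip_ext; [ | apply (lip_log_ratio (/ (2 * ln 2))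
      (1 + Pr * (1 - C) * y) (1 + Pr * (1 + C) * y)
      (1 + Pr * (1 - C) * y) (1 + Pr * (1 + C) * y) Ps Ps 0 0); lra ].
    intros x Hx. rewrite R_sr_ln by assumption. now rewrite Rmult_0_l, !Rplus_0_r.
  - intros x Hx. assert (0 <= Ps * x) by nra.
    eapply lip_ext; [ | apply (lip_log_ratio (/ (2 * ln 2))
      (1 + Ps * x) (1 + Ps * x) 1 1
      (Pr * (1 - C)) (Pr * (1 + C)) (Pr * (1 - C)) (Pr * (1 + C))); lra ].
    intros y Hy. rewrite R_sr_ln by assumption.
    f_equal. do 3 f_equal; f_equal; ring.
Qed.

Lemma lip_R_rd (Ps Pr C : R) :
  0 < Ps -> 0 < Pr -> 0 <= C < 1 ->
  exists k1 k2,
    (forall w, 0 <= w -> lip k1 (fun z => R_rd Ps Pr C z w)) /\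
    (forall z, 0 <= z -> lip k2 (R_rd Ps Pr C z)).
Proof.
  intros HPs HPr HC.
  assert (H1 : 0 <= Pr * (1 - C)) by nra. assert (H2 : 0 <= Pr * (1 + C)) by nra.
  assert (Hc := half_inv_ln2_pos).
  do 2 eexists. split.
  - intros w Hw. assert (0 <= Ps * w) by nra.
    eapply lip_ext; [ | apply (lip_log_ratio (/ (2 * ln 2))
      (1 + Ps * w) (1 + Ps * w) (1 + Ps * w) (1 + Ps * w)
      (Pr * (1 - C)) (Pr * (1 + C)) 0 0); lra ].
    intros z Hz. rewrite R_rd_ln by assumption. now rewrite Rmult_0_l, !Rplus_0_r.
  - intros z Hz.
    assert (0 <= Pr * (1 - C) * z) by nra. assert (0 <= Pr * (1 + C) * z) by nra.
    eapply lip_ext; [ | apply (lip_log_ratio (/ (2 * ln 2))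
      (1 + Pr * (1 - C) * z) (1 + Pr * (1 + C) * z) 1 1 Ps Ps Ps Ps); lra ].
    intros w Hw. rewrite R_rd_ln by assumption.
    f_equal. do 3 f_equal; f_equal; ring.
Qed.

(** By independence the two inner expectations see the first hop only through its rate [c]. Hence
    [R_EE] is the mean of this function at [R_sr], and [Rmin] makes it nondecreasing and 1-Lipschitz
    in [c]. *)
Definition capped_rd (Ps Pr C mz mw c : R) : R :=
  Ex mz (fun z => Ex mw (fun w => Rmin c (R_rd Ps Pr C z w))).

(** The constants are chosen before [c], because [good_Ex] asks for one constant valid at all
    parameters. *)
Lemma good_inner_capped_rd (Ps Pr C mw : R) :
  0 < Ps -> 0 < Pr -> 0 <= C < 1 -> 0 < mw ->
  exists k1 k2, forall c, 0 <= c ->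
    (forall z, 0 <= z -> good k2 (fun w => Rmin c (R_rd Ps Pr C z w))) /\
    good k1 (fun z => Ex mw (fun w => Rmin c (R_rd Ps Pr C z w))).
Proof.
  intros HPs HPr HC Hmw.
  destruct (lip_R_rd Ps Pr C HPs HPr HC) as (k1 & k2 & L1 & L2).
  exists k1, k2. intros c Hc.
  assert (G : forall z, 0 <= z -> good k2 (fun w => Rmin c (R_rd Ps Pr C z w))).
  { intros z Hz. split.
    - intros w Hw. apply Rmin_glb; [ exact Hc | now apply R_rd_nonneg ].
    - now apply lip_Rmin_r, L2. }
  split; [ exact G | ].
  apply (good_Ex mw k2 k1 (fun z w => Rmin c (R_rd Ps Pr C z w))); auto.
  intros w Hw. apply (lip_Rmin_r k1 c (fun z => R_rd Ps Pr C z w)). now apply L1.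
Qed.

Lemma good_capped_rd (Ps Pr C mz mw : R) :
  0 < Ps -> 0 < Pr -> 0 <= C < 1 -> 0 < mz -> 0 < mw ->
  good 1 (capped_rd Ps Pr C mz mw).
Proof.
  intros HPs HPr HC Hmz Hmw.
  destruct (good_inner_capped_rd Ps Pr C mw HPs HPr HC Hmw) as (k1 & k2 & G).
  apply (good_Ex mz k1 1 (fun c z => Ex mw (fun w => Rmin c (R_rd Ps Pr C z w))));
    [ exact Hmz | intros c Hc; now apply G | ].
  intros z Hz.
  apply (good_Ex mw k2 1 (fun c w => Rmin c (R_rd Ps Pr C z w)));
    [ exact Hmw | intros c Hc; now apply G | ].
  intros w Hw. apply (lip_Rmin_l 1 _ (fun c => c)), lip_id.
Qed.

Lemma nondecr_capped_rd (Ps Pr C mz mw : R) :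
  0 < Ps -> 0 < Pr -> 0 <= C < 1 -> 0 < mz -> 0 < mw ->
  nondecr (capped_rd Ps Pr C mz mw).
Proof.
  intros HPs HPr HC Hmz Hmw c c' Hc Hcc.
  destruct (good_inner_capped_rd Ps Pr C mw HPs HPr HC Hmw) as (k1 & k2 & G).
  destruct (G c Hc) as [G1 G2]. destruct (G c' ltac:(lra)) as [G1' G2'].
  apply Ex_mono with k1 k1; auto. intros z Hz.
  apply Ex_mono with k2 k2; auto. intros w Hw.
  apply Rle_min_compat_r, Hcc.
Qed.

Lemma capped_rd_le (Ps Pr C mz mw c : R) :
  0 < Ps -> 0 < Pr -> 0 <= C < 1 -> 0 < mz -> 0 < mw -> 0 <= c ->
  capped_rd Ps Pr C mz mw c <= c.
Proof.
  intros HPs HPr HC Hmz Hmw Hc.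
  destruct (good_inner_capped_rd Ps Pr C mw HPs HPr HC Hmw) as (k1 & k2 & G).
  destruct (G c Hc) as [G1 G2].
  apply Ex_le_const with k1; auto. intros z Hz.
  apply Ex_le_const with k2; auto. intros w Hw. apply Rmin_l.
Qed.

(** For [a1, a2 = 1 -+ alpha C] the product is [((1 + t)^2 - alpha^2 C^2) / (1 - alpha^2 C^2)], the
    ratio inside [R_sr] at [Pr g_rr = q] and [Ps g_sr = (1 + q) t], where [alpha = q / (q + 1)]. *)
Definition psi (a1 a2 t : R) : R := / 2 * log2 ((1 + t / a1) * (1 + t / a2)).
Definition dpsi (a1 a2 t : R) : R := / (2 * ln 2) * (/ (t + a1) + / (t + a2)).
(** A level increment times a lower bound for the probability that [R_rd] reaches that level, with
    [s = Ps pi_sd]. *)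
Definition layer_density (a1 a2 D s t : R) : R :=
  dpsi a1 a2 t * (exp (- t / D) / (1 + s * t / D)).

Lemma psi_0 (a1 a2 : R) : psi a1 a2 0 = 0.
Proof.
  unfold psi, log2. replace ((1 + 0 / a1) * (1 + 0 / a2)) with 1
    by (unfold Rdiv; ring).
  rewrite ln_1. unfold Rdiv. ring.
Qed.

Lemma is_derive_psi (a1 a2 t : R) :
  0 < a1 -> 0 < a2 -> 0 <= t -> is_derive (psi a1 a2) t (dpsi a1 a2 t).
Proof.
  intros H1 H2 Ht.
  assert (0 <= t / a1) by (apply Rdiv_le_0_compat; lra).
  assert (0 <= t / a2) by (apply Rdiv_le_0_compat; lra).
  unfold psi, log2, dpsi. auto_derive.
  - unfold Rdiv in *. nra.
  - field. repeat split; try lra. apply Rgt_not_eq, ln2_pos.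
Qed.

Lemma continuous_dpsi (a1 a2 t : R) :
  0 < a1 -> 0 < a2 -> 0 <= t -> continuous (dpsi a1 a2) t.
Proof.
  intros H1 H2 Ht. apply (@ex_derive_continuous R_AbsRing R_NormedModule).
  unfold dpsi. auto_derive. lra.
Qed.

Lemma dpsi_pos (a1 a2 t : R) : 0 < a1 -> 0 < a2 -> 0 <= t -> 0 < dpsi a1 a2 t.
Proof.
  intros H1 H2 Ht. unfold dpsi. apply Rmult_lt_0_compat; [ apply half_inv_ln2_pos | ].
  apply Rplus_lt_0_compat; apply Rinv_0_lt_compat; lra.
Qed.

Lemma continuous_clamp (f : R -> R) (x : R) :
  (forall t, 0 <= t -> continuous f t) -> continuous (fun t => f (Rmax 0 t)) x.
Proof.
  intros Hf. apply (continuous_comp (Rmax 0) f).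
  - apply lip_continuous with 1. intros u v. rewrite Rmult_1_l.
    apply Rmax_0_contraction.
  - apply Hf, Rmax_l.
Qed.

(** * The relay-to-destination hop *)

Lemma is_RInt_exp_dens_exp (m r c b : R) :
  0 < m -> 1 + m * r <> 0 ->
  is_RInt (fun w => exp_dens m w * exp (- (c + r * w))) 0 b
    ((exp (- c) - exp (- b / m) * exp (- (c + r * b))) / (1 + m * r)).
Proof.
  intros Hm Hr.
  replace ((exp (- c) - exp (- b / m) * exp (- (c + r * b))) / (1 + m * r))
    with (minus (- (exp (- b / m) * exp (- (c + r * b))) / (1 + m * r))
                (- (exp (- 0 / m) * exp (- (c + r * 0))) / (1 + m * r))).
  - apply (is_RInt_derive
             (fun w => - (exp (- w / m) * exp (- (c + r * w))) / (1 + m * r))).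
    + intros w _. unfold exp_dens, Rdiv. auto_derive; [ trivial | ].
      field. split; [ lra | exact Hr ].
    + intros w _. apply (@ex_derive_continuous R_AbsRing R_NormedModule).
      unfold exp_dens, Rdiv. auto_derive. exact I.
  - rewrite exp_0_div, Rmult_0_r, Rplus_0_r.
    unfold minus, plus, opp; simpl. field. exact Hr.
Qed.

(** Both logarithms have an argument [1 + (2 t + t^2) / p]: on the left [p = a1 a2], because
    [a1 + a2 = 2]; on the right the chosen gain makes [p = 1 - C^2], which is no larger. *)
Lemma psi_le_R_rd (Ps Pr C a1 a2 w t : R) :
  0 < Ps -> 0 < Pr -> 0 <= C < 1 -> 0 < a1 -> 0 < a2 ->
  a1 + a2 = 2 -> 1 - C ^ 2 <= a1 * a2 -> 0 <= w -> 0 <= t ->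
  psi a1 a2 t <= R_rd Ps Pr C (t * (1 + Ps * w) / (Pr * (1 - C ^ 2))) w.
Proof.
  intros HPs HPr HC H1 H2 Hsum Hprod Hw Ht.
  assert (Hc : 0 < 1 - C ^ 2) by nra.
  assert (Hw' : 0 < Ps * w + 1) by nra.
  assert (0 < a1 * a2) by nra.
  unfold psi, R_rd. apply Rmult_le_compat_l; [ lra | ].
  replace ((1 + t / a1) * (1 + t / a2)) with (1 + (2 * t + t ^ 2) * / (a1 * a2))
    by (rewrite <- Hsum; field; lra).
  set (V := t * (1 + Ps * w) / (Pr * (1 - C ^ 2))).
  replace (((Pr * V + Ps * w + 1) ^ 2 - (Pr * V * C) ^ 2) / (Ps * w + 1) ^ 2)
    with (1 + (2 * t + t ^ 2) * / (1 - C ^ 2))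
    by (unfold V; field; repeat split; lra).
  assert (Hq : 0 <= 2 * t + t ^ 2) by nra.
  apply log2_le.
  - assert (0 < / (a1 * a2)) by now apply Rinv_0_lt_compat. nra.
  - apply Rplus_le_compat_l, Rmult_le_compat_l; [ exact Hq | ].
    now apply Rinv_le_contravar.
Qed.

Lemma continuous_layer_density (a1 a2 D s t : R) :
  0 < a1 -> 0 < a2 -> 0 < D -> 0 < s -> 0 <= t ->
  continuous (layer_density a1 a2 D s) t.
Proof.
  intros H1 H2 HD Hs Ht.
  assert (0 <= s * t / D) by (apply Rdiv_le_0_compat; nra).
  unfold layer_density.
  apply (continuous_mult (dpsi a1 a2) (fun t => exp (- t / D) / (1 + s * t / D))).
  - now apply continuous_dpsi.
  - apply (@ex_derive_continuous R_AbsRing R_NormedModule).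
    unfold Rdiv in *. auto_derive. lra.
Qed.

Lemma layer_density_pos (a1 a2 D s t : R) :
  0 < a1 -> 0 < a2 -> 0 < D -> 0 < s -> 0 <= t -> 0 < layer_density a1 a2 D s t.
Proof.
  intros H1 H2 HD Hs Ht.
  assert (0 <= s * t / D) by (apply Rdiv_le_0_compat; nra).
  apply Rmult_lt_0_compat; [ now apply dpsi_pos | ].
  apply Rdiv_lt_0_compat; [ apply exp_pos | lra ].
Qed.

Lemma ex_RInt_continuous_nonneg (f : R -> R) (T : R) :
  0 <= T -> (forall t, 0 <= t -> continuous f t) -> ex_RInt f 0 T.
Proof.
  intros HT Hf. apply (ex_RInt_continuous (V := R_CompleteNormedModule)).
  intros t Ht. rewrite Rmin_left, Rmax_right in Ht by exact HT. apply Hf. lra.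
Qed.

Lemma nondecr_psi (a1 a2 : R) : 0 < a1 -> 0 < a2 -> nondecr (psi a1 a2).
Proof.
  intros H1 H2 t T Ht HtT. unfold psi. apply Rmult_le_compat_l; [ lra | ].
  assert (0 <= t / a1) by (apply Rdiv_le_0_compat; lra).
  assert (0 <= t / a2) by (apply Rdiv_le_0_compat; lra).
  assert (t / a1 <= T / a1)
    by (apply Rmult_le_compat_r; [ left; now apply Rinv_0_lt_compat | lra ]).
  assert (t / a2 <= T / a2)
    by (apply Rmult_le_compat_r; [ left; now apply Rinv_0_lt_compat | lra ]).
  apply log2_le; [ nra | ]. apply Rmult_le_compat; lra.
Qed.

Lemma psi_nonneg (a1 a2 t : R) : 0 < a1 -> 0 < a2 -> 0 <= t -> 0 <= psi a1 a2 t.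
Proof.
  intros H1 H2 Ht. rewrite <- (psi_0 a1 a2). apply nondecr_psi; lra.
Qed.

(** At fixed [w] the gain supplied by [psi_le_R_rd] is linear in [t], so the layer bound applies
    with a linear [phi]; its exponent is also affine in [w], ready for the average over [w]. *)
Lemma layer_le_Ex_min_R_rd (Ps Pr C mz a1 a2 D w T : R) :
  0 < Ps -> 0 < Pr -> 0 <= C < 1 -> 0 < mz -> 0 < a1 -> 0 < a2 ->
  a1 + a2 = 2 -> 1 - C ^ 2 <= a1 * a2 -> D = Pr * mz * (1 - C ^ 2) ->
  0 <= w -> 0 <= T ->
  RInt (fun t => dpsi a1 a2 t * exp (- (t / D + t * Ps / D * w))) 0 T
  <= Ex mz (fun z => Rmin (psi a1 a2 T) (R_rd Ps Pr C z w)).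
Proof.
  intros HPs HPr HC Hmz H1 H2 Hsum Hprod HD Hw HT.
  assert (Hc : 0 < 1 - C ^ 2) by nra.
  assert (HPc : 0 < Pr * (1 - C ^ 2)) by nra.
  assert (HDpos : 0 < D) by (rewrite HD; assert (0 < Pr * mz) by nra; nra).
  destruct (lip_R_rd Ps Pr C HPs HPr HC) as (k1 & _ & L1 & _).
  assert (Hpsi : forall t, 0 <= t <= T -> psi a1 a2 t <= psi a1 a2 T)
    by (intros t Ht; apply nondecr_psi; lra).
  assert (Hpsi0 := psi_nonneg a1 a2 T H1 H2 HT).
  apply Rle_trans with
    (RInt (fun t => dpsi a1 a2 t
       * exp (- (t * ((1 + Ps * w) / (Pr * (1 - C ^ 2)))) / mz)) 0 T).
  { right. apply RInt_ext. intros t _. do 2 f_equal. rewrite HD. field. lra. }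
  apply (Ex_ge_layer mz k1 T (fun z => Rmin (psi a1 a2 T) (R_rd Ps Pr C z w))
           (fun t => t * ((1 + Ps * w) / (Pr * (1 - C ^ 2))))
           (fun _ => (1 + Ps * w) / (Pr * (1 - C ^ 2))) (psi a1 a2)); auto.
  - split.
    + intros z Hz. apply Rmin_glb; [ exact Hpsi0 | now apply R_rd_nonneg ].
    + apply (lip_Rmin_r k1 _ (fun z => R_rd Ps Pr C z w)). now apply L1.
  - intros z z' Hz Hzz. apply Rle_min_compat_l.
    now apply (nondecr_R_rd Ps Pr C w).
  - intros t Ht.
    assert (0 <= (1 + Ps * w) / (Pr * (1 - C ^ 2)))
      by (apply Rdiv_le_0_compat; nra).
    refine (conj _ (conj _ (conj _ _))).
    + generalize ((1 + Ps * w) / (Pr * (1 - C ^ 2))). intros r.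
      auto_derive; [ exact I | ring ].
    + apply continuous_const.
    + assumption.
    + nra.
  - intros t Ht. refine (conj _ (conj _ _)).
    + apply is_derive_psi; lra.
    + apply continuous_dpsi; lra.
    + apply Rmin_glb; [ now apply Hpsi | ].
      apply Rle_trans with (1 := psi_le_R_rd Ps Pr C a1 a2 w t HPs HPr HC H1 H2
                                  Hsum Hprod Hw (proj1 Ht)).
      right. f_equal. field. lra.
  - ring.
  - apply psi_0.
Qed.

(** [capped_rd] integrates over [w] inside [z], whereas the layer bound in [z] holds at fixed [w],
    so the order is exchanged first. The average over [w] is then the Laplace transform of an
    exponential law, the source of the factor [/ (1 + s * t / D)]. *)
Lemma layer_le_capped_rd (Ps Pr C mz mw a1 a2 D T : R) :
  0 < Ps -> 0 < Pr -> 0 <= C < 1 -> 0 < mz -> 0 < mw -> 0 < a1 -> 0 < a2 ->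
  a1 + a2 = 2 -> 1 - C ^ 2 <= a1 * a2 -> D = Pr * mz * (1 - C ^ 2) -> 0 <= T ->
  RInt (layer_density a1 a2 D (Ps * mw)) 0 T
  <= capped_rd Ps Pr C mz mw (psi a1 a2 T).
Proof.
  intros HPs HPr HC Hmz Hmw H1 H2 Hsum Hprod HD HT.
  assert (Hc : 0 < 1 - C ^ 2) by nra.
  assert (HDpos : 0 < D) by (rewrite HD; assert (0 < Pr * mz) by nra; nra).
  assert (Hs : 0 < Ps * mw) by nra.
  set (c := psi a1 a2 T).
  assert (Hc0 : 0 <= c) by (now apply psi_nonneg).
  set (N := RInt (layer_density a1 a2 D (Ps * mw)) 0 T).
  assert (HexN : ex_RInt (layer_density a1 a2 D (Ps * mw)) 0 T).
  { apply ex_RInt_continuous_nonneg; auto.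
    intros t Ht. now apply continuous_layer_density. }
  assert (HN0 : 0 <= N).
  { apply RInt_ge_0; auto. intros t Ht. left. apply layer_density_pos; lra. }
  destruct (lip_R_rd Ps Pr C HPs HPr HC) as (k1 & k2 & L1 & L2).
  assert (Hgood : good k2 (fun w => Ex mz (fun z => Rmin c (R_rd Ps Pr C z w)))).
  { apply (good_Ex mz k1 k2 (fun w z => Rmin c (R_rd Ps Pr C z w))); auto.
    - intros w Hw. split.
      + intros z Hz. apply Rmin_glb; [ exact Hc0 | now apply R_rd_nonneg ].
      + apply (lip_Rmin_r k1 c (fun z => R_rd Ps Pr C z w)). now apply L1.
    - intros z Hz. now apply lip_Rmin_r, L2. }
  apply Rle_trans with (Ex mw (fun w => Ex mz (fun z => Rmin c (R_rd Ps Pr C z w)))).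
  2:{ apply (Ex_swap_le mz mw k1 k2 c (fun z w => Rmin c (R_rd Ps Pr C z w))); auto.
      - intros w Hw. apply (lip_Rmin_r k1 c (fun z => R_rd Ps Pr C z w)). now apply L1.
      - intros z Hz. now apply lip_Rmin_r, L2.
      - intros z w Hz Hw. split.
        + apply Rmin_glb; [ exact Hc0 | now apply R_rd_nonneg ].
        + apply Rmin_l. }
  (* [dpsi] has poles at negative [t]; the clamp gives the continuity on the whole plane that
     [RInt_swap] asks for. *)
  set (f := fun w t => exp_dens mw w
              * (dpsi a1 a2 (Rmax 0 t) * exp (- (t / D + t * Ps / D * w)))).
  assert (Hf : forall w t, continuity_2d_pt f w t).
  { intros w t. apply continuity_2d_pt_mult; [ | apply continuity_2d_pt_mult ].
    - apply continuity_1d_2d_pt_comp; [ | apply continuity_2d_pt_id1 ].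
      apply continuity_pt_filterlim, exp_dens_continuous.
    - apply (continuity_1d_2d_pt_comp (fun t => dpsi a1 a2 (Rmax 0 t)) (fun w t => t));
        [ | apply continuity_2d_pt_id2 ].
      apply continuity_pt_filterlim.
      apply (continuous_clamp (dpsi a1 a2)). intros u Hu. now apply continuous_dpsi.
    - apply (continuity_1d_2d_pt_comp exp); [ apply derivable_continuous, derivable_exp | ].
      apply continuity_2d_pt_opp, continuity_2d_pt_plus; unfold Rdiv.
      + apply continuity_2d_pt_mult;
          [ apply continuity_2d_pt_id2 | apply continuity_2d_pt_const ].
      + apply continuity_2d_pt_mult; [ | apply continuity_2d_pt_id1 ].
        apply continuity_2d_pt_mult; [ | apply continuity_2d_pt_const ].
        apply continuity_2d_pt_mult;
          [ apply continuity_2d_pt_id2 | apply continuity_2d_pt_const ]. }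
  (* Truncating the Laplace integral at [B] keeps at least the fraction [1 - exp (- B / mw)] of it,
     whatever the nonnegative rate [t * Ps / D]. The fraction is uniform in [t] and so factors out
     of [N]. *)
  assert (Hcut : forall B, 0 <= B -> (1 - exp (- B / mw)) * N
            <= Ex mw (fun w => Ex mz (fun z => Rmin c (R_rd Ps Pr C z w)))).
  { intros B HB.
    apply Rle_trans with (2 := RInt_le_Ex mw k2 B _ Hmw Hgood HB).
    apply Rle_trans with (RInt (fun w => RInt (f w) 0 T) 0 B).
    - rewrite RInt_swap by auto. unfold N.
      rewrite <- RInt_scal_R by exact HexN.
      apply RInt_le; auto.
      + apply ex_RInt_scal_R. exact HexN.
      + apply ex_RInt_continuous_everywhere. intros t.
        apply (continuous_RInt_param (fun t w => f w t)); auto.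
        intros t' w'. apply (continuity_2d_pt_swap f), Hf.
      + intros t Ht.
        assert (Hr : 0 <= t * Ps / D) by (apply Rdiv_le_0_compat; nra).
        assert (H1r : 0 < 1 + mw * (t * Ps / D)) by nra.
        assert (Hin : is_RInt (fun w => f w t) 0 B
          (dpsi a1 a2 t * ((exp (- (t / D)) - exp (- B / mw)
             * exp (- (t / D + t * Ps / D * B))) / (1 + mw * (t * Ps / D))))).
        { apply (is_RInt_ext (fun w => scal (dpsi a1 a2 t)
                   (exp_dens mw w * exp (- (t / D + t * Ps / D * w))))).
          - intros w _. unfold f. rewrite Rmax_right by lra.
            unfold scal; simpl; unfold mult; simpl. ring.
          - apply (is_RInt_scal (V := R_NormedModule)).
            apply is_RInt_exp_dens_exp; lra. }
        rewrite (is_RInt_unique _ _ _ _ Hin).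
        unfold layer_density.
        replace (1 + Ps * mw * t / D) with (1 + mw * (t * Ps / D)) by (field; lra).
        replace (- t / D) with (- (t / D)) by (field; lra).
        assert (Hexp : exp (- (t / D + t * Ps / D * B)) <= exp (- (t / D))).
        { assert (0 <= t * Ps / D * B) by nra.
          destruct (Req_dec (t * Ps / D * B) 0) as [-> | Hne].
          - rewrite Rplus_0_r. lra.
          - left. apply exp_increasing. lra. }
        assert (Hd := dpsi_pos a1 a2 t H1 H2 ltac:(lra)).
        replace ((1 - exp (- B / mw))
                 * (dpsi a1 a2 t * (exp (- (t / D)) / (1 + mw * (t * Ps / D)))))
          with (dpsi a1 a2 t * ((1 - exp (- B / mw)) * exp (- (t / D))
                                / (1 + mw * (t * Ps / D))))
          by (unfold Rdiv; ring).
        apply Rmult_le_compat_l; [ lra | ].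
        apply Rmult_le_compat_r; [ left; now apply Rinv_0_lt_compat | ].
        generalize (exp_pos (- B / mw)). nra.
    - apply RInt_le; auto.
      + apply ex_RInt_continuous_everywhere. intros w. now apply continuous_RInt_param.
      + apply ex_RInt_exp_dens with k2; auto; try lra. apply Hgood.
      + intros w Hw.
        apply Rle_trans with (exp_dens mw w * RInt (fun t => dpsi a1 a2 t
                  * exp (- (t / D + t * Ps / D * w))) 0 T).
        * right. rewrite <- RInt_scal_R.
          -- apply RInt_ext. intros t Ht. rewrite Rmin_left, Rmax_right in Ht by lra.
             unfold f. rewrite Rmax_right by lra. reflexivity.
          -- apply ex_RInt_continuous_nonneg; auto. intros t Ht.
             apply (continuous_mult (dpsi a1 a2)
                      (fun t => exp (- (t / D + t * Ps / D * w)))).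
             ++ now apply continuous_dpsi.
             ++ apply (@ex_derive_continuous R_AbsRing R_NormedModule).
                unfold Rdiv. auto_derive. exact I.
        * apply exp_dens_mult_le; auto.
          apply layer_le_Ex_min_R_rd; auto. lra. }
  apply le_epsilon. intros eps Heps.
  destruct (exp_opp_div_small mw (eps / (N + 1)) Hmw) as [B [HB0 HB]].
  { apply Rdiv_lt_0_compat; lra. }
  destruct (HB B (Rle_refl B)) as [Hsmall _].
  specialize (Hcut B HB0).
  apply Rmult_le_compat_r with (r := N + 1) in Hsmall; [ | lra ].
  replace (eps / (N + 1) * (N + 1)) with eps in Hsmall by (field; lra).
  generalize (exp_pos (- B / mw)). nra.
Qed.

(** * The source-to-relay hop *)

(* With [Y = P_r g_rr], the exact value of [P_s g_sr] at which [R_sr] reaches the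
   level [psi t] is the concave function
   [sqrt (g (Y+1)^2 - (g-1) C^2 Y^2) - (Y+1)], [g = ((1+t)^2 - alpha^2 C^2) / (1 - alpha^2 C^2)].
   This is its tangent line at the mean [Y = alpha / (1 - alpha)]. *)
Definition sr_threshold (C alpha Y t : R) : R :=
  (Y + 1 - C ^ 2 * alpha * Y) / (1 - alpha ^ 2 * C ^ 2) * (1 + t - / (1 + t))
  + (Y + 1) * / (1 + t) - (Y + 1).

Definition dsr_threshold (C alpha Y t : R) : R :=
  (Y + 1 - C ^ 2 * alpha * Y) / (1 - alpha ^ 2 * C ^ 2) * (1 + / (1 + t) ^ 2)
  - (Y + 1) * / (1 + t) ^ 2.

(** The coefficient of [Y] in [sr_threshold], that is, the derivative of the concave threshold at
    the mean. It multiplies [Y - q] and therefore averages out. *)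
Definition sr_slope (C alpha t : R) : R :=
  (1 - C ^ 2 * alpha) / (1 - alpha ^ 2 * C ^ 2) * (1 + t - / (1 + t)) + / (1 + t) - 1.

Lemma is_derive_sr_threshold (C alpha Y t : R) :
  0 <= t -> is_derive (sr_threshold C alpha Y) t (dsr_threshold C alpha Y t).
Proof.
  intros Ht. unfold sr_threshold, dsr_threshold.
  generalize ((Y + 1 - C ^ 2 * alpha * Y) / (1 - alpha ^ 2 * C ^ 2)). intros r.
  auto_derive; [ lra | field; lra ].
Qed.

Lemma continuous_dsr_threshold (C alpha Y t : R) :
  0 <= t -> continuous (dsr_threshold C alpha Y) t.
Proof.
  intros Ht. apply (@ex_derive_continuous R_AbsRing R_NormedModule).
  unfold dsr_threshold.
  generalize ((Y + 1 - C ^ 2 * alpha * Y) / (1 - alpha ^ 2 * C ^ 2)). intros r.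
  auto_derive. assert (0 < (1 + t) * ((1 + t) * 1)) by nra. lra.
Qed.

(** The coefficient is at least [(Y + 1) / 2], which makes the threshold nonnegative and
    nondecreasing in [t]. After clearing the denominator the difference is [1 + alpha^2 C^2] plus
    [Y (1 - 2 alpha C^2 + alpha^2 C^2)], and the last bracket is [(1 - alpha C^2)^2 + alpha^2 C^2 (1
    - C^2)]. *)
Lemma sr_coef_bounds (C alpha Y : R) :
  0 <= C < 1 -> 0 <= alpha < 1 -> 0 <= Y ->
  0 < 1 - alpha ^ 2 * C ^ 2 /\
  Y + 1 <= 2 * ((Y + 1 - C ^ 2 * alpha * Y) / (1 - alpha ^ 2 * C ^ 2)).
Proof.
  intros HC Ha HY.
  assert (HC2 : 0 <= C ^ 2 < 1) by nra.
  assert (Ha2 : 0 <= alpha ^ 2 < 1) by nra.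
  assert (Hb : 0 < 1 - alpha ^ 2 * C ^ 2) by nra.
  split; [ exact Hb | ].
  unfold Rdiv. rewrite <- Rmult_assoc. apply Rle_div_r; [ exact Hb | ].
  assert (0 <= Y * ((1 - C ^ 2 * alpha) ^ 2 + alpha ^ 2 * C ^ 2 * (1 - C ^ 2))).
  { apply Rmult_le_pos; [ exact HY | ].
    assert (0 <= alpha ^ 2 * C ^ 2) by (apply Rmult_le_pos; lra).
    assert (0 <= (1 - C ^ 2 * alpha) ^ 2) by apply pow2_ge_0. nra. }
  nra.
Qed.

Lemma dsr_threshold_nonneg (C alpha Y t : R) :
  0 <= C < 1 -> 0 <= alpha < 1 -> 0 <= Y -> 0 <= t -> 0 <= dsr_threshold C alpha Y t.
Proof.
  intros HC Ha HY Ht. destruct (sr_coef_bounds C alpha Y HC Ha HY) as [_ Hk].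
  unfold dsr_threshold.
  set (k := (Y + 1 - C ^ 2 * alpha * Y) / (1 - alpha ^ 2 * C ^ 2)) in *.
  assert (Hi : 0 < / (1 + t) ^ 2 <= 1).
  { split; [ apply Rinv_0_lt_compat; nra | ].
    rewrite <- Rinv_1. apply Rinv_le_contravar; nra. }
  nra.
Qed.

Lemma sr_threshold_0 (C alpha Y : R) : sr_threshold C alpha Y 0 = 0.
Proof.
  unfold sr_threshold. rewrite Rplus_0_r, Rinv_1. ring.
Qed.

Lemma sr_threshold_nonneg (C alpha Y t : R) :
  0 <= C < 1 -> 0 <= alpha < 1 -> 0 <= Y -> 0 <= t -> 0 <= sr_threshold C alpha Y t.
Proof.
  intros HC Ha HY Ht. destruct (sr_coef_bounds C alpha Y HC Ha HY) as [_ Hk].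
  unfold sr_threshold.
  set (k := (Y + 1 - C ^ 2 * alpha * Y) / (1 - alpha ^ 2 * C ^ 2)) in *.
  set (i := / (1 + t)).
  assert (Hi : 0 < i <= 1).
  { unfold i. split; [ apply Rinv_0_lt_compat; lra | ].
    rewrite <- Rinv_1. apply Rinv_le_contravar; lra. }
  assert (Hit : (1 + t) * i = 1) by (unfold i; field; lra).
  assert (Ht2 : 0 <= 1 + t - i) by lra.
  assert ((Y + 1) / 2 * (1 + t - i) <= k * (1 + t - i))
    by (apply Rmult_le_compat_r; lra).
  (* A positive number and its inverse sum to at least 2, here [1 + t] and [i]. *)
  assert (0 <= (Y + 1) / 2 * (1 + t + i - 2)); [ | nra ].
  apply Rmult_le_pos; [ lra | ]. nra.
Qed.

(** Expansion about the mean [q], the point where [alpha (Y + 1) = Y]. The leading term is linear in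
    [t] thanks to the choice of [psi]. *)
Lemma sr_threshold_affine (C q Y t : R) :
  0 < q -> 0 <= C < 1 -> 0 <= t ->
  sr_threshold C (q / (q + 1)) Y t
  = (1 + q) * t + sr_slope C (q / (q + 1)) t * (Y - q).
Proof.
  intros Hq HC Ht.
  assert (Ha : 0 <= q / (q + 1) < 1).
  { split; [ apply Rdiv_le_0_compat; lra | apply Rlt_div_l; lra ]. }
  destruct (sr_coef_bounds C (q / (q + 1)) 0 HC Ha (Rle_refl 0)) as [Hb _].
  assert (Hq' : (q / (q + 1)) * (q + 1) = q) by (field; lra).
  set (alpha := q / (q + 1)) in *.
  assert (Hlin : Y + 1 - C ^ 2 * alpha * Y
     = (1 + q) * (1 - alpha ^ 2 * C ^ 2) + (1 - C ^ 2 * alpha) * (Y - q)).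
  { replace ((1 + q) * (1 - alpha ^ 2 * C ^ 2))
      with (1 + q - alpha * (q + 1) * alpha * C ^ 2) by ring.
    rewrite Hq'. ring. }
  unfold sr_threshold, sr_slope. rewrite Hlin. field. lra.
Qed.

(** The tangent line lies above the concave threshold, so at its value the rate has already reached
    the level. To avoid the square root, the squared form is used: [g u^2 - (g - 1) C^2 v^2] is
    evaluated at [(Y + 1, Y)] and at [(1, alpha)], where it equals [(1 + t)^2], and the tangent
    comes from its polarisation. *)
Lemma psi_le_R_sr (Ps Pr C alpha y t : R) :
  0 < Ps -> 0 < Pr -> 0 <= C < 1 -> 0 <= alpha < 1 -> 0 <= y -> 0 <= t ->
  psi (1 - alpha * C) (1 + alpha * C) t
  <= R_sr Ps Pr C (sr_threshold C alpha (Pr * y) t / Ps) y.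
Proof.
  intros HPs HPr HC Ha Hy Ht.
  assert (HY : 0 <= Pr * y) by nra.
  destruct (sr_coef_bounds C alpha (Pr * y) HC Ha HY) as [Hb _].
  unfold psi, R_sr. apply Rmult_le_compat_l; [ lra | ].
  replace (Ps * (sr_threshold C alpha (Pr * y) t / Ps))
    with (sr_threshold C alpha (Pr * y) t) by (field; lra).
  set (Y := Pr * y) in *.
  set (beta := 1 - alpha ^ 2 * C ^ 2) in *.
  set (g := 1 + (2 * t + t ^ 2) / beta).
  assert (Hac : 0 <= alpha * C < 1) by nra.
  replace ((1 + t / (1 - alpha * C)) * (1 + t / (1 + alpha * C))) with g.
  2:{ unfold g, beta. field. repeat split; try lra. apply Rgt_not_eq. nra. }
  assert (Hg : 1 <= g).
  { unfold g. assert (0 <= (2 * t + t ^ 2) / beta); [ | lra ].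
    apply Rdiv_le_0_compat; nra. }
  assert (Hgb : (1 + t) ^ 2 = g - (g - 1) * (alpha ^ 2 * C ^ 2)).
  { replace (g - (g - 1) * (alpha ^ 2 * C ^ 2)) with ((g - 1) * beta + 1)
      by (unfold beta; ring).
    unfold g. field. lra. }
  assert (Hthr : sr_threshold C alpha Y t + Y + 1
                 = (g * (Y + 1) - (g - 1) * C ^ 2 * alpha * Y) / (1 + t)).
  { unfold sr_threshold. fold beta. unfold g. field. lra. }
  assert (Hden : 0 < (Y + 1) ^ 2 - (Y * C) ^ 2).
  { replace ((Y + 1) ^ 2 - (Y * C) ^ 2)
      with ((Y + 1 - Y * C) * (Y + 1 + Y * C)) by ring.
    assert (0 <= Y * C) by nra. assert (Y * C <= Y) by nra.
    apply Rmult_lt_0_compat; lra. }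
  apply log2_le; [ lra | ]. apply Rle_div_r; [ exact Hden | ].
  rewrite Hthr.
  assert (Hkey : g * (Y + 1) ^ 2 - (g - 1) * C ^ 2 * Y ^ 2
                 <= ((g * (Y + 1) - (g - 1) * C ^ 2 * alpha * Y) / (1 + t)) ^ 2).
  { replace (((g * (Y + 1) - (g - 1) * C ^ 2 * alpha * Y) / (1 + t)) ^ 2)
      with ((g * (Y + 1) - (g - 1) * C ^ 2 * alpha * Y) ^ 2 / (1 + t) ^ 2)
      by (field; lra).
    apply Rle_div_r; [ nra | ]. rewrite Hgb.
    (* reversed Cauchy-Schwarz for the indefinite form [g u^2 - (g-1) C^2 v^2] *)
    assert (0 <= g * (g - 1) * C ^ 2 * (Y - alpha * (Y + 1)) ^ 2).
    { apply Rmult_le_pos; [ | apply pow2_ge_0 ].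
      apply Rmult_le_pos; [ apply Rmult_le_pos; lra | apply pow2_ge_0 ]. }
    nra. }
  nra.
Qed.

(** The layer bound is used a second time, now in [g_sr] at fixed [g_rr = y], with the bound for the
    other hop as the attained levels [N]. The lower bound is affine in [y], so it serves as the
    supporting line for Jensen; its value at the mean [Pr y = q] is the wanted integral. *)
Lemma Ex_capped_sr_ge (Ps Pr C m mz mw q alpha D y T : R) :
  0 < Ps -> 0 < Pr -> 0 <= C < 1 -> 0 < m -> 0 < mz -> 0 < mw -> 0 < q ->
  alpha = q / (q + 1) -> D = Pr * mz * (1 - C ^ 2) -> 0 <= y -> 0 <= T ->
  let a1 := 1 - alpha * C in let a2 := 1 + alpha * C in
  let n := layer_density a1 a2 D (Ps * mw) in
  let e := fun t => exp (- ((1 + q) / (Ps * m) * t)) in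
  RInt (fun t => n t * e t) 0 T
  - (Pr * y - q) / (Ps * m) * RInt (fun t => n t * e t * sr_slope C alpha t) 0 T
  <= Ex m (fun x => capped_rd Ps Pr C mz mw (Rmin (R_sr Ps Pr C x y) (psi a1 a2 T))).
Proof.
  intros HPs HPr HC Hm Hmz Hmw Hq Halpha HD Hy HT a1 a2 n e.
  assert (Ha : 0 <= alpha < 1).
  { rewrite Halpha. split; [ apply Rdiv_le_0_compat; lra | apply Rlt_div_l; lra ]. }
  assert (Hac : 0 <= alpha * C < 1) by nra.
  assert (H1 : 0 < a1) by (unfold a1; lra).
  assert (H2 : 0 < a2) by (unfold a2; lra).
  assert (HY : 0 <= Pr * y) by nra.
  assert (Hc : 0 < 1 - C ^ 2) by nra.
  assert (HDpos : 0 < D) by (rewrite HD; assert (0 < Pr * mz) by nra; nra).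
  assert (Hs : 0 < Ps * mw) by nra.
  assert (Hprod : 1 - C ^ 2 <= a1 * a2).
  { unfold a1, a2. assert (alpha ^ 2 <= 1) by nra.
    assert (alpha ^ 2 * C ^ 2 <= 1 * C ^ 2)
      by (apply Rmult_le_compat_r; [ apply pow2_ge_0 | assumption ]).
    nra. }
  assert (Hsum : a1 + a2 = 2) by (unfold a1, a2; ring).
  assert (Hncont : forall t, 0 <= t -> continuous n t)
    by (intros t Ht; now apply continuous_layer_density).
  assert (Hecont : forall t, continuous e t).
  { intros t. apply (@ex_derive_continuous R_AbsRing R_NormedModule).
    unfold e. auto_derive. exact I. }
  assert (Hscont : forall t, 0 <= t -> continuous (sr_slope C alpha) t).
  { intros t Ht. apply (@ex_derive_continuous R_AbsRing R_NormedModule).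
    unfold sr_slope.
    generalize ((1 - C ^ 2 * alpha) / (1 - alpha ^ 2 * C ^ 2)). intros r.
    auto_derive. lra. }
  assert (Hne : ex_RInt (fun t => n t * e t) 0 T).
  { apply ex_RInt_continuous_nonneg; auto. intros t Ht.
    apply (continuous_mult n e); auto. }
  assert (Hnes : ex_RInt (fun t => n t * e t * sr_slope C alpha t) 0 T).
  { apply ex_RInt_continuous_nonneg; auto. intros t Ht.
    apply (continuous_mult (fun t => n t * e t) (sr_slope C alpha)); auto.
    apply (continuous_mult n e); auto. }
  destruct (lip_R_sr Ps Pr C HPs HPr HC) as (k1 & k2 & L1 & L2).
  destruct (good_capped_rd Ps Pr C mz mw HPs HPr HC Hmz Hmw) as [M0 ML].
  assert (MM := nondecr_capped_rd Ps Pr C mz mw HPs HPr HC Hmz Hmw).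
  set (M := capped_rd Ps Pr C mz mw) in *.
  assert (HpsiT := psi_nonneg a1 a2 T H1 H2 HT).
  assert (Hmin0 : forall x, 0 <= x -> 0 <= Rmin (R_sr Ps Pr C x y) (psi a1 a2 T)).
  { intros x Hx. apply Rmin_glb; [ now apply R_sr_nonneg | exact HpsiT ]. }
  (* [n] is controlled only for nonnegative [t]. Its clamped version is continuous everywhere, so
     its integral has a two-sided derivative at [t = 0] too. *)
  set (nh := fun t => n (Rmax 0 t)).
  assert (Hnh : forall t, continuous nh t) by (intros t; now apply continuous_clamp).
  assert (HnhN : forall t, 0 <= t -> RInt nh 0 t = RInt n 0 t).
  { intros t Ht. apply RInt_ext. intros u Hu. rewrite Rmin_left in Hu by exact Ht.
    unfold nh. rewrite Rmax_right by lra. reflexivity. }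
  assert (Hlayer : RInt (fun t => nh t
             * exp (- (sr_threshold C alpha (Pr * y) t / Ps) / m)) 0 T
           <= Ex m (fun x => M (Rmin (R_sr Ps Pr C x y) (psi a1 a2 T)))).
  { apply (Ex_ge_layer m k1 T (fun x => M (Rmin (R_sr Ps Pr C x y) (psi a1 a2 T)))
      (fun t => sr_threshold C alpha (Pr * y) t / Ps)
      (fun t => dsr_threshold C alpha (Pr * y) t / Ps) (fun t => RInt nh 0 t) nh); auto.
    - split; [ intros x Hx; auto | ].
      intros x x' Hx Hx'.
      apply Rle_trans with (1 := ML _ _ (Hmin0 x Hx) (Hmin0 x' Hx')).
      rewrite Rmult_1_l. apply Rle_trans with (1 := Rmin_l_contraction _ _ _).
      now apply (L1 y Hy).
    - intros x x' Hx Hxx. apply MM; auto. apply Rle_min_compat_r.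
      now apply (nondecr_R_sr Ps Pr C y).
    - intros t Ht. refine (conj _ (conj _ (conj _ _))).
      + apply (is_derive_ext (fun t => scal (/ Ps) (sr_threshold C alpha (Pr * y) t))).
        * intros u. apply Rmult_comm.
        * replace (dsr_threshold C alpha (Pr * y) t / Ps)
            with (scal (/ Ps) (dsr_threshold C alpha (Pr * y) t)) by apply Rmult_comm.
          apply (is_derive_scal (sr_threshold C alpha (Pr * y))).
          apply is_derive_sr_threshold. lra.
      + apply (continuous_mult (dsr_threshold C alpha (Pr * y)) (fun _ => / Ps)).
        * apply continuous_dsr_threshold. lra.
        * apply continuous_const.
      + apply Rdiv_le_0_compat; [ apply dsr_threshold_nonneg; lra | exact HPs ].
      + apply Rdiv_le_0_compat; [ apply sr_threshold_nonneg; lra | exact HPs ].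
    - intros t Ht. refine (conj _ (conj _ _)).
      + now apply is_derive_RInt_upper.
      + apply Hnh.
      + rewrite HnhN by lra.
        apply Rle_trans with (M (psi a1 a2 t)).
        * apply layer_le_capped_rd; auto. lra.
        * apply MM; [ apply psi_nonneg; lra | ].
          apply Rmin_glb; [ apply psi_le_R_sr; lra | apply nondecr_psi; lra ].
    - rewrite sr_threshold_0. unfold Rdiv. ring.
    - exact (RInt_point 0 nh). }
  apply Rle_trans with (2 := Hlayer).
  set (K := - ((Pr * y - q) / (Ps * m))).
  replace (RInt (fun t => n t * e t) 0 T - (Pr * y - q) / (Ps * m)
             * RInt (fun t => n t * e t * sr_slope C alpha t) 0 T)
    with (RInt (fun t => n t * e t + K * (n t * e t * sr_slope C alpha t)) 0 T).
  2:{ rewrite RInt_plus_R, RInt_scal_R; auto.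
      - unfold K, Rminus. now rewrite Ropp_mult_distr_l.
      - apply ex_RInt_scal_R. exact Hnes. }
  apply RInt_le; auto.
  - apply ex_RInt_plus_R; auto.
    apply ex_RInt_scal_R. exact Hnes.
  - apply ex_RInt_continuous_nonneg; auto. intros t Ht.
    apply (continuous_mult nh
      (fun t => exp (- (sr_threshold C alpha (Pr * y) t / Ps) / m))); auto.
    apply (continuous_comp (sr_threshold C alpha (Pr * y)) (fun u => exp (- (u / Ps) / m))).
    + apply (@ex_derive_continuous R_AbsRing R_NormedModule).
      eexists. now apply is_derive_sr_threshold.
    + apply (@ex_derive_continuous R_AbsRing R_NormedModule).
      unfold Rdiv. auto_derive. exact I.
  - intros t Ht. unfold nh. rewrite Rmax_right by lra.
    assert (Haff := sr_threshold_affine C q (Pr * y) t Hq HC ltac:(lra)).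
    rewrite <- Halpha in Haff. rewrite Haff.
    replace (exp (- (((1 + q) * t + sr_slope C alpha t * (Pr * y - q)) / Ps) / m))
      with (e t * exp (K * sr_slope C alpha t))
      by (unfold e; rewrite <- exp_plus; f_equal; unfold K; field; lra).
    assert (Hnpos : 0 < n t) by (apply layer_density_pos; lra).
    assert (Hepos : 0 < e t) by apply exp_pos.
    (* The inequality [1 + u <= exp u] is the convexity behind Jensen: it turns the exponential of
       an affine function of [y] into an affine lower bound. *)
    assert (Hexp := exp_ineq1_le (K * sr_slope C alpha t)).
    assert (Hne0 : 0 < n t * e t) by now apply Rmult_lt_0_compat.
    nra.
Qed.

(** Jensen over [g_rr] needs [g_sr] integrated first, the reverse of the order in [R_EE]. Capping
    [R_sr] at [psi T] lowers the expectation and provides the bound under which the two gains may be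
    exchanged. *)
Lemma RInt_rate_layer_le_R_EE (Ps Pr C m my mz mw alpha D T : R) :
  0 < Ps -> 0 < Pr -> 0 <= C < 1 -> 0 < m -> 0 < my -> 0 < mz -> 0 < mw ->
  alpha = Pr * my / (Pr * my + 1) -> D = Pr * mz * (1 - C ^ 2) -> 0 <= T ->
  RInt (fun t => layer_density (1 - alpha * C) (1 + alpha * C) D (Ps * mw) t
                 * exp (- ((1 + Pr * my) / (Ps * m) * t))) 0 T
  <= R_EE Ps Pr C m my mz mw.
Proof.
  intros HPs HPr HC Hm Hmy Hmz Hmw Halpha HD HT.
  assert (Hq : 0 < Pr * my) by nra.
  assert (Ha : 0 <= alpha < 1).
  { rewrite Halpha. split; [ apply Rdiv_le_0_compat; lra | apply Rlt_div_l; lra ]. }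
  assert (Hac : 0 <= alpha * C < 1) by nra.
  destruct (lip_R_sr Ps Pr C HPs HPr HC) as (k1 & k2 & L1 & L2).
  destruct (good_capped_rd Ps Pr C mz mw HPs HPr HC Hmz Hmw) as [M0 ML].
  assert (MM := nondecr_capped_rd Ps Pr C mz mw HPs HPr HC Hmz Hmw).
  assert (Mle : forall c, 0 <= c -> capped_rd Ps Pr C mz mw c <= c)
    by (intros c Hc; now apply capped_rd_le).
  assert (Hgoal := fun y Hy => Ex_capped_sr_ge Ps Pr C m mz mw (Pr * my) alpha D y T
    HPs HPr HC Hm Hmz Hmw Hq Halpha HD Hy HT).
  cbv beta zeta in Hgoal.
  (* True by unfolding: [Expect4] is four nested [Ex], and the inner two form [capped_rd] at the
     level [R_sr]. *)
  change (R_EE Ps Pr C m my mz mw)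
    with (Ex m (fun x => Ex my (fun y => capped_rd Ps Pr C mz mw (R_sr Ps Pr C x y)))).
  set (M := capped_rd Ps Pr C mz mw) in *.
  set (c := psi (1 - alpha * C) (1 + alpha * C) T) in *.
  assert (Hc : 0 <= c) by (apply psi_nonneg; lra).
  assert (Hsr : forall x y, 0 <= x -> 0 <= y -> 0 <= R_sr Ps Pr C x y)
    by (intros; now apply R_sr_nonneg).
  assert (Hmin : forall x y, 0 <= x -> 0 <= y -> 0 <= Rmin (R_sr Ps Pr C x y) c)
    by (intros; apply Rmin_glb; auto).
  set (h := fun x y => M (Rmin (R_sr Ps Pr C x y) c)).
  assert (Hh1 : forall y, 0 <= y -> lip k1 (fun x => h x y)).
  { intros y Hy x x' Hx Hx'.
    apply Rle_trans with (1 := ML _ _ (Hmin x y Hx Hy) (Hmin x' y Hx' Hy)).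
    rewrite Rmult_1_l. apply Rle_trans with (1 := Rmin_l_contraction _ _ _).
    now apply (L1 y Hy). }
  assert (Hh2 : forall x, 0 <= x -> lip k2 (h x)).
  { intros x Hx y y' Hy Hy'.
    apply Rle_trans with (1 := ML _ _ (Hmin x y Hx Hy) (Hmin x y' Hx Hy')).
    rewrite Rmult_1_l. apply Rle_trans with (1 := Rmin_l_contraction _ _ _).
    now apply (L2 x Hx). }
  assert (Hh : forall x y, 0 <= x -> 0 <= y -> 0 <= h x y <= c).
  { intros x y Hx Hy. split; [ now apply M0, Hmin | ].
    apply Rle_trans with (1 := Mle _ (Hmin x y Hx Hy)). apply Rmin_r. }
  assert (Gh1 : forall y, 0 <= y -> good k1 (fun x => h x y))
    by (intros y Hy; split; [ intros x Hx; now apply Hh | auto ]).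
  assert (Gh2 : forall x, 0 <= x -> good k2 (h x))
    by (intros x Hx; split; [ intros y Hy; now apply Hh | auto ]).
  assert (Gr2 : forall x, 0 <= x -> good k2 (fun y => M (R_sr Ps Pr C x y))).
  { intros x Hx. split; [ auto | ]. intros y y' Hy Hy'.
    apply Rle_trans with (1 := ML _ _ (Hsr x y Hx Hy) (Hsr x y' Hx Hy')).
    rewrite Rmult_1_l. now apply (L2 x Hx). }
  apply Rle_trans with (Ex m (fun x => Ex my (h x))).
  - apply Rle_trans with (2 := Ex_swap_le m my k1 k2 c h Hm Hmy Hh1 Hh2 Hh).
    set (L := RInt _ 0 T).
    set (K := RInt (fun t => layer_density (1 - alpha * C) (1 + alpha * C) D (Ps * mw) t
       * exp (- ((1 + Pr * my) / (Ps * m) * t)) * sr_slope C alpha t) 0 T) in *.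
    apply (Ex_ge_affine my k2 L (- (Pr / (Ps * m) * K))); auto.
    + apply (good_Ex m k1 k2 (fun y x => h x y)); auto.
    + intros y Hy. apply Rle_trans with (2 := Hgoal y Hy). right. fold L. field. lra.
  - apply Ex_mono with k1 k1; auto.
    + apply (good_Ex my k2 k1 h); auto.
    + apply (good_Ex my k2 k1 (fun x y => M (R_sr Ps Pr C x y))); auto.
      intros y Hy x x' Hx Hx'.
      apply Rle_trans with (1 := ML _ _ (Hsr x y Hx Hy) (Hsr x' y Hx' Hy)).
      rewrite Rmult_1_l. now apply (L1 y Hy).
    + intros x Hx. apply Ex_mono with k2 k2; auto.
      intros y Hy. apply MM; [ now apply Hmin | apply Rmin_l ].
Qed.

(** * Evaluation of the bound *)

Lemma continuous_E1_integrand (x t : R) :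
  0 < t -> continuous (fun t => exp (- (x * t)) / t) t.
Proof.
  intros Ht. apply (@ex_derive_continuous R_AbsRing R_NormedModule).
  auto_derive. lra.
Qed.

(** On [[1, b]] the factor [1 / t] is at most 1, so the partial integrals are bounded by [/ x] and
    [Int_inf] is a genuine limit here. *)
Lemma is_lim_E1 (x : R) :
  0 < x -> is_lim (fun b => RInt (fun t => exp (- (x * t)) / t) 1 b) p_infty (Defs.E1 x).
Proof.
  intros Hx.
  assert (Hex : forall b, 1 <= b -> ex_RInt (fun t => exp (- (x * t)) / t) 1 b).
  { intros b Hb. apply (ex_RInt_continuous (V := R_CompleteNormedModule)).
    intros t Ht. rewrite Rmin_left in Ht by exact Hb.
    apply continuous_E1_integrand. lra. }
  apply is_lim_Int_inf with (/ x).
  - exact Hex.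
  - intros t Ht. left. apply Rdiv_lt_0_compat; [ apply exp_pos | lra ].
  - intros b Hb.
    assert (Hmaj : is_RInt (fun t => exp (- (x * t))) 1 b
                     (minus (- exp (- (x * b)) / x) (- exp (- (x * 1)) / x))).
    { apply (is_RInt_derive (fun t => - exp (- (x * t)) / x)).
      - intros t _. unfold Rdiv. auto_derive; [ exact I | field; lra ].
      - intros t _. apply (@ex_derive_continuous R_AbsRing R_NormedModule).
        auto_derive. exact I. }
    apply Rle_trans with (RInt (fun t => exp (- (x * t))) 1 b).
    + apply RInt_le; auto.
      * eexists. exact Hmaj.
      * intros t Ht. apply Rle_div_l; [ lra | ].
        rewrite <- (Rmult_1_r (exp (- (x * t)))) at 1.
        apply Rmult_le_compat_l; [ left; apply exp_pos | lra ].
    + rewrite (is_RInt_unique _ _ _ _ Hmaj). unfold minus, plus, opp; simpl.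
      assert (Hi : 0 < / x) by now apply Rinv_0_lt_compat.
      assert (H1 : exp (- (x * 1)) <= 1)
        by (rewrite <- exp_0 at 2; left; apply exp_increasing; lra).
      assert (Hb0 := exp_pos (- (x * b))).
      assert (exp (- (x * 1)) * / x <= 1 * / x) by (apply Rmult_le_compat_r; lra).
      assert (0 <= exp (- (x * b)) * / x) by (apply Rmult_le_pos; lra).
      unfold Rdiv. lra.
Qed.

(** The substitution of [t / a + 1] for the variable of [E1 (c a)] moves the lower limit from 1 to
    0; the prefactor [exp (c a)] of [Xi1] cancels the resulting shift in the exponent. *)
Lemma is_lim_Xi1 (c a : R) :
  0 < c -> 0 < a ->
  is_lim (fun T => RInt (fun t => exp (- (c * t)) / (t + a)) 0 T) p_infty (Xi1 (c * a)).
Proof.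
  intros Hc Ha.
  assert (Hca : 0 < c * a) by now apply Rmult_lt_0_compat.
  set (F := fun b => RInt (fun t => exp (- (c * a * t)) / t) 1 b).
  assert (Hsub : forall T, 0 < T ->
            exp (c * a) * F (/ a * T + 1) = RInt (fun t => exp (- (c * t)) / (t + a)) 0 T).
  { intros T HT.
    assert (Hex : ex_RInt (fun t => exp (- (c * t)) / (t + a)) 0 T).
    { apply ex_RInt_continuous_nonneg; [ lra | ]. intros t Ht.
      apply (@ex_derive_continuous R_AbsRing R_NormedModule).
      auto_derive. lra. }
    unfold F. replace 1 with (/ a * 0 + 1) at 1 by ring.
    rewrite <- (RInt_comp (V := R_CompleteNormedModule)
                  (fun t => exp (- (c * a * t)) / t) (fun t => / a * t + 1) (fun _ => / a)).
    - rewrite <- RInt_scal_R.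
      + apply RInt_ext. intros t Ht. rewrite Rmin_left, Rmax_right in Ht by lra.
        unfold scal; simpl; unfold mult; simpl.
        replace (exp (- (c * t)))
          with (exp (c * a) * exp (- (c * a * (/ a * t + 1))))
          by (rewrite <- exp_plus; f_equal; field; lra).
        field. split; [ lra | ]. lra.
      + apply (ex_RInt_ext (fun t => scal (exp (- (c * a))) (exp (- (c * t)) / (t + a)))).
        * intros t Ht. rewrite Rmin_left, Rmax_right in Ht by lra.
          unfold scal; simpl; unfold mult; simpl.
          replace (exp (- (c * a * (/ a * t + 1))))
            with (exp (- (c * a)) * exp (- (c * t)))
            by (rewrite <- exp_plus; f_equal; field; lra).
          field. lra.
        * now apply ex_RInt_scal_R.
    - intros t Ht. rewrite Rmin_left, Rmax_right in Ht by lra.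
      apply continuous_E1_integrand.
      assert (0 < / a) by now apply Rinv_0_lt_compat. nra.
    - intros t _. split.
      + auto_derive; [ exact I | ring ].
      + apply continuous_const. }
  apply (is_lim_ext_loc (fun T => exp (c * a) * F (/ a * T + 1))).
  - exists 0. exact Hsub.
  - unfold Xi1.
    apply (is_lim_scal_l (fun T => F (/ a * T + 1)) (exp (c * a)) p_infty (Defs.E1 (c * a))).
    apply (is_lim_comp_lin F (/ a) 1 p_infty (Defs.E1 (c * a))).
    + replace (Rbar_plus (Rbar_mult (/ a) p_infty) 1) with p_infty.
      * now apply is_lim_E1.
      * symmetry. rewrite Rbar_mult_comm, (is_Rbar_mult_unique p_infty (/ a) p_infty); auto.
        apply is_Rbar_mult_p_infty_pos. now apply Rinv_0_lt_compat.
    + apply Rgt_not_eq. now apply Rinv_0_lt_compat.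
Qed.

(** [dpsi] is already a sum over the poles [- a1] and [- a2], so each term is only separated from
    the pole [- D / s]. The two inequations keep that pole away from the others, while [a1 = a2] is
    allowed. Since [a1 + a2 = 2], the two contributions at [- D / s] merge into the coefficient
    [kappa3]. *)
Lemma layer_density_partial_fractions (a1 a2 D s lam t : R) :
  0 < a1 -> 0 < a2 -> a1 + a2 = 2 -> 0 < D -> 0 < s -> 0 <= t ->
  D <> s * a1 -> D <> s * a2 ->
  let g := fun a => exp (- ((lam + 1 / D) * t)) / (t + a) in
  layer_density a1 a2 D s t * exp (- (lam * t)) =
  D / (s * ln 2) *
    (/ 2 * s / (D - s * a1) * g a1 + / 2 * s / (D - s * a2) * g a2
     + s * (s - D) / ((D - s * a1) * (D - s * a2)) * g (D / s)).
Proof.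
  intros H1 H2 Hsum HD Hs Ht Hn1 Hn2 g. unfold layer_density, dpsi, g.
  replace (exp (- ((lam + 1 / D) * t))) with (exp (- t / D) * exp (- (lam * t)))
    by (rewrite <- exp_plus; f_equal; field; lra).
  replace (1 + s * t / D) with ((D + s * t) / D) by (field; lra).
  replace (t + D / s) with ((D + s * t) / s) by (field; lra).
  assert (Ha2 : a2 = 2 - a1) by lra. rewrite Ha2 in *.
  assert (Hln := ln2_pos). assert (0 <= s * t) by nra.
  field. repeat split; lra.
Qed.

Theorem theorem8 (Ps Pr Cx pi_sr pi_rr pi_rd pi_sd : R) :
  0 < Ps -> 0 < Pr -> 0 < pi_sr -> 0 < pi_rr -> 0 < pi_rd -> 0 < pi_sd ->
  0 <= Cx < 1 ->
  let alpha := Pr * pi_rr / (Pr * pi_rr + 1) in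
  let a1 := 1 - alpha * Cx in
  let a2 := 1 + alpha * Cx in
  let D := Pr * pi_rd * (1 - Cx ^ 2) in
  D <> Ps * pi_sd * a1 -> D <> Ps * pi_sd * a2 ->
  let kappa1 := / 2 * Ps * pi_sd / (D - Ps * pi_sd * a1) in
  let kappa2 := / 2 * Ps * pi_sd / (D - Ps * pi_sd * a2) in
  let kappa3 := Ps * pi_sd * (Ps * pi_sd - D)
                / ((D - Ps * pi_sd * (1 - alpha * Cx)) * (D - Ps * pi_sd * (1 + alpha * Cx))) in
  R_EE Ps Pr Cx pi_sr pi_rr pi_rd pi_sd >=
    D / (Ps * pi_sd * ln 2) *
      (kappa1 * Xi1 (Pr * pi_rr * a1 / (alpha * Ps * pi_sr) + a1 / D)
       + kappa2 * Xi1 (Pr * pi_rr * a2 / (alpha * Ps * pi_sr) + a2 / D)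
       + kappa3 * Xi1 (Pr ^ 2 * pi_rd * pi_rr * (1 - Cx ^ 2)
                         / (alpha * Ps ^ 2 * pi_sd * pi_sr) + 1 / (Ps * pi_sd))).
Proof.
  intros HPs HPr Hsr Hrr Hrd Hsd HC alpha a1 a2 D Hn1 Hn2 kappa1 kappa2 kappa3.
  assert (Hq : 0 < Pr * pi_rr) by nra.
  assert (Ha : 0 < alpha < 1).
  { unfold alpha. split; [ apply Rdiv_lt_0_compat; lra | apply Rlt_div_l; lra ]. }
  assert (Hac : 0 <= alpha * Cx < 1) by nra.
  assert (H1 : 0 < a1) by (unfold a1; lra).
  assert (H2 : 0 < a2) by (unfold a2; lra).
  assert (Hc : 0 < 1 - Cx ^ 2) by nra.
  assert (HD : 0 < D) by (unfold D; assert (0 < Pr * pi_rd) by nra; nra).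
  set (s := Ps * pi_sd) in *.
  assert (Hs : 0 < s) by (unfold s; nra).
  set (lam := (1 + Pr * pi_rr) / (Ps * pi_sr)).
  assert (Hlam : 0 < lam) by (unfold lam; apply Rdiv_lt_0_compat; nra).
  set (c := lam + 1 / D).
  assert (HcD : 0 < 1 / D) by (apply Rdiv_lt_0_compat; lra).
  assert (Hcpos : 0 < c) by (unfold c; lra).
  (* This shows all three arguments of [Xi1] to be [c] times [a1], [a2] and [D / s], the negatives
     of the poles. *)
  assert (Hqa : Pr * pi_rr / alpha = 1 + Pr * pi_rr) by (unfold alpha; field; lra).
  assert (HDs : 0 < D / s) by (apply Rdiv_lt_0_compat; lra).
  assert (Earg : forall a, Pr * pi_rr * a / (alpha * Ps * pi_sr) + a / D = c * a).
  { intros a. unfold c, lam. rewrite <- Hqa. field. repeat split; lra. }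
  assert (Earg3 : Pr ^ 2 * pi_rd * pi_rr * (1 - Cx ^ 2) / (alpha * Ps ^ 2 * pi_sd * pi_sr)
                  + 1 / s = c * (D / s)).
  { unfold c, lam. rewrite <- Hqa.
    replace ((Pr * pi_rr / alpha / (Ps * pi_sr) + 1 / D) * (D / s))
      with (Pr * pi_rr / alpha / (Ps * pi_sr) * (D / s) + 1 / s) by (field; lra).
    unfold D, s. field. repeat split; lra. }
  rewrite !Earg, Earg3.
  replace kappa1 with (/ 2 * s / (D - s * a1)) by (unfold kappa1, s, Rdiv; ring).
  replace kappa2 with (/ 2 * s / (D - s * a2)) by (unfold kappa2, s, Rdiv; ring).
  change kappa3 with (s * (s - D) / ((D - s * a1) * (D - s * a2))).
  apply Rle_ge.
  set (k1 := / 2 * s / (D - s * a1)). set (k2 := / 2 * s / (D - s * a2)).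
  set (k3 := s * (s - D) / ((D - s * a1) * (D - s * a2))).
  set (I_ := fun a T => RInt (fun t => exp (- (c * t)) / (t + a)) 0 T).
  (* [R_EE] does not depend on [T], so the limit removes the cap. The [kappa]'s can have either
     sign, so the limit is taken in an identity for the whole combination and not term by term in
     inequalities. *)
  apply (is_lim_le_loc
           (fun T => D / (s * ln 2) * (k1 * I_ a1 T + k2 * I_ a2 T + k3 * I_ (D / s) T))
           (fun _ => R_EE Ps Pr Cx pi_sr pi_rr pi_rd pi_sd) p_infty
           (Finite _) (Finite _)).
  - exists 0. intros T HT.
    assert (HexI : forall a, 0 < a ->
              ex_RInt (fun t => exp (- (c * t)) / (t + a)) 0 T).
    { intros a Hapos. apply ex_RInt_continuous_nonneg; [ lra | ]. intros t Ht.
      apply (@ex_derive_continuous R_AbsRing R_NormedModule). auto_derive. lra. }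
    assert (HexkI : forall k a, 0 < a ->
              ex_RInt (fun t => k * (exp (- (c * t)) / (t + a))) 0 T).
    { intros k a Hapos. apply ex_RInt_scal_R; auto. }
    apply Rle_trans with (2 := RInt_rate_layer_le_R_EE Ps Pr Cx pi_sr pi_rr pi_rd pi_sd
      alpha D T HPs HPr HC Hsr Hrr Hrd Hsd eq_refl eq_refl ltac:(lra)).
    right. unfold I_.
    rewrite <- !RInt_scal_R by auto.
    assert (Hex12 := ex_RInt_plus_R _ _ _ _
                       (HexkI k1 a1 H1) (HexkI k2 a2 H2)).
    assert (Hex123 := ex_RInt_plus_R _ _ _ _
                        Hex12 (HexkI k3 (D / s) HDs)).
    rewrite <- (RInt_plus_R _ _ 0 T (HexkI k1 a1 H1) (HexkI k2 a2 H2)).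
    rewrite <- (RInt_plus_R _ _ 0 T Hex12 (HexkI k3 (D / s) HDs)).
    rewrite <- (RInt_scal_R _ 0 T (D / (s * ln 2)) Hex123).
    apply RInt_ext. intros t Ht. rewrite Rmin_left, Rmax_right in Ht by lra.
    symmetry. apply layer_density_partial_fractions; unfold a1, a2 in *; lra.
  - apply (is_lim_scal_l _ (D / (s * ln 2)) p_infty (Finite _)).
    apply (is_lim_plus' _ _ p_infty _ _).
    + apply (is_lim_plus' _ _ p_infty _ _).
      * apply (is_lim_scal_l _ k1 p_infty (Finite _)), is_lim_Xi1; auto.
      * apply (is_lim_scal_l _ k2 p_infty (Finite _)), is_lim_Xi1; auto.
    + apply (is_lim_scal_l _ k3 p_infty (Finite _)), is_lim_Xi1; auto.
  - apply is_lim_const.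
Qed.
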